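(* Let $c\in(0,3]$ and let $f\in\mathcal{F}^0(c)$. Then the pre-Schwarzian norm of $f$ satisfies $$\|P_f\|\leq c.$$ The inequality is sharp, i.e. there exists $f\in\mathcal{F}^0(c)$ with $\|P_f\|=c$.
   Context: $\mathbb{D}=\{z\in\mathbb{C}:|z|<1\}$. $\mathcal{A}$ is the class of analytic functions $f$ on $\mathbb{D}$ with $f(0)=0$ and $f'(0)=1$. For $c\in(0,3]$, $\mathcal{F}(c)$ is the class of $f\in\mathcal{A}$ (with $f'$ nonvanishing on $\mathbb{D}$) such that $\operatorname{Re}\left(1+\frac{zf''(z)}{f'(z)}\right)>1-\frac{c}{2}$ for all $z\in\mathbb{D}$, and $\mathcal{F}^0(c)=\{f\in\mathcal{F}(c): f''(0)=0\}$. The pre-Schwarzian derivative is $P_f=f''/f'$ and its norm is $\|P_f\|=\sup_{z\in\mathbb{D}}(1-|z|^2)|P_f(z)|$. *)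

(* Defs.v *)
From Stdlib Require Export Reals.
From Coquelicot Require Export Coquelicot.
Open Scope R_scope.

(* Functions on the unit disk are total functions [C -> C]; everything below
   depends only on their values on the disk, which is open. *)
Definition unit_disk (z : C) : Prop := Cmod z < 1.

Definition analytic_at (f : C -> C) (z0 : C) : Prop :=
  exists (a : nat -> C) (r : R), 0 < r /\
    forall z : C, Cmod (z - z0)%C < r ->
      is_pseries (K := C_AbsRing) (V := C_NormedModule) a (z - z0)%C (f z).

Definition analytic_on (U : C -> Prop) (f : C -> C) : Prop :=
  forall z : C, U z -> analytic_at f z.

Definition class_A (f : C -> C) : Prop :=
  analytic_on unit_disk f /\ f 0%C = 0%C /\ C_derive f 0%C = 1%C.

Definition C_derive2 (f : C -> C) : C -> C := C_derive (C_derive f).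

Definition pre_Schwarzian (f : C -> C) (z : C) : C :=
  (C_derive2 f z / C_derive f z)%C.

(* The supremum is taken in [Rbar], since it may be infinite. *)
Definition pre_Schwarzian_norm (f : C -> C) : Rbar :=
  Lub_Rbar (fun x : R => exists z : C, unit_disk z /\
    x = (1 - Cmod z ^ 2) * Cmod (pre_Schwarzian f z)).

Definition class_F (c : R) (f : C -> C) : Prop :=
  class_A f /\
  (forall z : C, unit_disk z -> C_derive f z <> 0%C) /\
  (forall z : C, unit_disk z ->
     Re (1 + z * C_derive2 f z / C_derive f z)%C > 1 - c / 2).

Definition class_F0 (c : R) (f : C -> C) : Prop :=
  class_F c f /\ C_derive2 f 0%C = 0%C.

(* Main.v *)
(* With [u = z f'' / f'], the condition [Re u > - c / 2] says that
   [w = u / (c + u)] maps the disk into itself, and [f''(0) = 0] makes [w] vanish to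
   order two at [0].  Hence [|w| <= |z|^2] by the maximum principle, and
   [u = c w / (1 - w)] gives [(1 - |z|^2) |f'' / f'| <= c |z|].  Equality is
   approached along the real axis when [w = z^2], that is, when
   [f' = (1 - z^2)^(- c / 2)].

   The maximum principle only needs second order Taylor expansions, which are stable
   under quotients; for locally analytic functions they come from recentering
   power series. *)
Require Import Defs.
From Stdlib Require Import Reals Lra Lia ClassicalEpsilon.
From Coquelicot Require Import Coquelicot.
Open Scope R_scope.

(** * Recentering complex power series *)

(** [analytic_at] gives a separate series at each centre, while [C_derive] is a limit at one point.
    Recentering links them: the linear coefficient at the new centre is the value of [C_derive], and
    it is again the sum of a power series in that centre. Hence [f'] and [f''] are analytic too.

    The function to be bounded, [w / z ^ 2], is written as [(f'' / z) / (c f' + z f'')]. The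
    denominator has no zero in the disk, so the only singularity to remove is that of [f'' / z] at
    [0], by shifting one power series.

    For sharpness no branch of a complex power is chosen. [f'] is given by its Taylor coefficients,
    whose recurrence is the equation [(1 - z ^ 2) F' = c z F]; this yields [f'' / f'] at once. The
    solutions for [c] and [- c] have constant product, which proves that [f'] has no zero. The bound
    [c <= 3] enters here: it keeps the coefficients for both signs below [n + 1], which gives
    convergence on the whole disk. *)

Notation Cseries := (@is_series C_AbsRing C_NormedModule).
Definition Csum (u : nat -> C) (n : nat) : C := @sum_n C_AbelianGroup u n.

Lemma is_pseries_Cseries (a : nat -> C) (z l : C) :
  is_pseries (K := C_AbsRing) (V := C_NormedModule) a z l <->
  Cseries (fun n => (a n * z ^ n)%C) l.
Proof.
  unfold is_pseries; split; apply is_series_ext; intro n.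
  - change (z ^ n * a n = a n * z ^ n)%C; ring.
  - change (a n * z ^ n = z ^ n * a n)%C; ring.
Qed.

Lemma Csum_O (u : nat -> C) : Csum u 0 = u 0%nat.
Proof. exact (sum_O u). Qed.

Lemma Rsum_O (u : nat -> R) : sum_n u 0 = u 0%nat :> R.
Proof. exact (sum_O u). Qed.

Lemma Rsum_S (u : nat -> R) (n : nat) : sum_n u (S n) = sum_n u n + u (S n) :> R.
Proof. exact (sum_Sn u n). Qed.

Lemma Csum_S (u : nat -> C) (n : nat) : Csum u (S n) = (Csum u n + u (S n))%C.
Proof. exact (sum_Sn u n). Qed.

Lemma Cmod_Csum_le (u : nat -> C) (v : nat -> R) (n : nat) :
  (forall n, Cmod (u n) <= v n) -> Cmod (Csum u n) <= sum_n v n.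
Proof.
  intro Huv; induction n as [|n IH].
  - rewrite Csum_O, sum_O; auto.
  - rewrite Csum_S, sum_Sn.
    eapply Rle_trans; [apply Cmod_triangle|].
    apply Rplus_le_compat; auto.
Qed.

Lemma Cseries_norm_le (u : nat -> C) (v : nat -> R) (l : C) (L : R) :
  Cseries u l -> is_series v L -> (forall n, Cmod (u n) <= v n) -> Cmod l <= L.
Proof.
  intros Hu Hv Huv.
  assert (H1 : is_lim_seq (fun n => norm (sum_n u n)) (norm l)).
  { eapply filterlim_comp; [exact Hu | apply filterlim_norm]. }
  assert (H2 : is_lim_seq (sum_n v) L) by exact Hv.
  apply (is_lim_seq_le _ _ (norm l) L) with (2 := H1) (3 := H2).
  intro n; exact (Cmod_Csum_le u v n Huv).
Qed.

(** A term is the difference of two consecutive partial sums, and these are bounded because they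
    converge. *)
Lemma Cseries_terms_bounded (u : nat -> C) (l : C) :
  Cseries u l -> exists M, forall n, Cmod (u n) <= M.
Proof.
  intro Hu.
  assert (Hex : ex_finite_lim_seq (fun n => norm (sum_n u n))).
  { exists (norm l). eapply filterlim_comp; [exact Hu | apply filterlim_norm]. }
  assert (Hb : exists M, forall n, Cmod (sum_n u n) <= M).
  { destruct Hex as [x Hx]. 
    destruct (filterlim_bounded (fun n => norm (sum_n u n))) as [M HM].
    { exists x; exact Hx. }
    exists M; intro n; eapply Rle_trans; [|apply (HM n)]. 
    apply Rle_abs. }
  destruct Hb as [M HM]; exists (M + M); intros [|n].
  - pose proof (HM 0%nat) as H0; rewrite Csum_O in H0.
    pose proof (Cmod_ge_0 (u 0%nat)); lra.
  - replace (u (S n)) with (Csum u (S n) + - Csum u n)%C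
      by (rewrite Csum_S; ring).
    eapply Rle_trans; [apply Cmod_triangle|]; rewrite Cmod_opp.
    apply Rplus_le_compat; apply HM.
Qed.

Lemma ex_Cseries (u : nat -> C) (v : nat -> R) :
  (forall n, Cmod (u n) <= v n) -> ex_series v -> exists l, Cseries u l.
Proof.
  intros H1 H2.
  exact (@ex_series_le C_AbsRing C_CompleteNormedModule u v H1 H2).
Qed.

(** Abel's lemma: the terms are dominated by the geometric series [M * (s / r) ^ n]. *)
Lemma ex_series_geom_bound (c : nat -> R) (M r s : R) :
  0 <= s < r -> (forall n, 0 <= c n) -> (forall n, c n * r ^ n <= M) ->
  ex_series (fun n => c n * s ^ n).
Proof.
  intros Hs Hc HM.
  apply (@ex_series_le R_AbsRing R_CompleteNormedModule _
           (fun n => M * (s / r) ^ n)).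
  - intro n.
    assert (0 <= s ^ n) by (apply pow_le; lra).
    assert (0 < r ^ n) by (apply pow_lt; lra).
    change (Rabs (c n * s ^ n) <= M * (s / r) ^ n).
    rewrite Rabs_pos_eq by (apply Rmult_le_pos; auto).
    unfold Rdiv; rewrite Rpow_mult_distr, pow_inv.
    replace (c n * s ^ n) with ((c n * r ^ n) * (s ^ n * / r ^ n)) by (field; lra).
    apply Rmult_le_compat_r; auto.
    apply Rmult_le_pos; auto; left; apply Rinv_0_lt_compat; auto.
  - apply (ex_series_scal_l (K := R_AbsRing) M (fun n => (s / r) ^ n)), ex_series_geom.
    rewrite Rabs_pos_eq by (apply Rdiv_le_0_compat; lra).
    apply Rlt_div_l; lra.
Qed.

Lemma Cseries_plus (u v : nat -> C) (l m : C) :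
  Cseries u l -> Cseries v m -> Cseries (fun n => (u n + v n)%C) (l + m)%C.
Proof. exact (@is_series_plus C_AbsRing C_NormedModule u v l m). Qed.

Lemma Cseries_scal (c : C) (u : nat -> C) (l : C) :
  Cseries u l -> Cseries (fun n => (c * u n)%C) (c * l)%C.
Proof. exact (@is_series_scal C_AbsRing C_NormedModule c u l). Qed.

Lemma Cseries_incr_n (u : nat -> C) (n : nat) (l : C) :
  Cseries u l -> Cseries (fun k => u (S n + k)%nat) (l - Csum u n)%C.
Proof.
  intro H.
  apply (is_series_incr_n (V := C_NormedModule) u (S n)); [lia|].
  simpl pred.
  match goal with |- is_series _ ?x => replace x with l; [exact H|] end.
  change (l = (l - Csum u n) + Csum u n)%C; ring.
Qed.

Lemma Cseries_unique (u : nat -> C) (l m : C) :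
  Cseries u l -> Cseries u m -> l = m.
Proof.
  intros H1 H2.
  exact (filterlim_locally_unique (F := eventually) (sum_n u) l m H1 H2).
Qed.

Lemma Cseries_ext (u v : nat -> C) (l : C) :
  (forall n, u n = v n) -> Cseries u l -> Cseries v l.
Proof. intros; eapply is_series_ext; eauto. Qed.

(* [shift_coef z n k] is the coefficient of [w ^ k] in [(z + w) ^ n]. *)
Fixpoint shift_coef (z : C) (n k : nat) : C :=
  match n, k with
  | O, O => 1%C
  | O, S _ => 0%C
  | S n, O => (z * shift_coef z n 0)%C
  | S n, S k => (z * shift_coef z n (S k) + shift_coef z n k)%C
  end.

(** Any truncation [K >= n] is allowed, since recentering cuts all the expansions of [(z + w) ^ n]
    at one common [K]. *)
Lemma shift_coef_sum (z w : C) (n : nat) :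
  forall K, (n <= K)%nat ->
  Csum (fun k => (shift_coef z n k * w ^ k)%C) K = ((z + w) ^ n)%C.
Proof.
  (* Pascal's rule is multiplication by [z + w]; the part multiplied by [w] moves up one degree, so
     its truncation is [K] instead of [S K]. *)
  assert (Hrec : forall n K,
    Csum (fun k => (shift_coef z (S n) k * w ^ k)%C) (S K) =
    (z * Csum (fun k => (shift_coef z n k * w ^ k)%C) (S K) +
     w * Csum (fun k => (shift_coef z n k * w ^ k)%C) K)%C).
  { intro m; induction K as [|K IH].
    - rewrite !Csum_S, !Csum_O; simpl; ring.
    - rewrite Csum_S, IH, !Csum_S; cbn [shift_coef]; rewrite !Cpow_S; ring. }
  induction n as [|n IH]; intros K HK.
  - clear HK; induction K as [|K IH].
    + rewrite Csum_O; simpl; ring.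
    + rewrite Csum_S, IH; simpl; ring.
  - destruct K as [|K]; [lia|].
    rewrite Hrec, !IH by lia; rewrite Cpow_S; ring.
Qed.

(** The triangle inequality in Pascal's rule compares with the binomial expansion of
    [(Cmod z + t) ^ n]. The bound is uniform in [K], so it also controls expansions cut too
    early. *)
Lemma shift_coef_abs_sum (z : C) (t : R) (n : nat) : 0 <= t ->
  forall K,
  sum_n (fun k => Cmod (shift_coef z n k) * t ^ k) K <= (Cmod z + t) ^ n.
Proof.
  intros Ht.
  assert (Hp : forall k, 0 <= t ^ k) by (intro; apply pow_le; auto).
  assert (Hrec : forall n K,
    sum_n (fun k => Cmod (shift_coef z (S n) k) * t ^ k) (S K) <=
    Cmod z * sum_n (fun k => Cmod (shift_coef z n k) * t ^ k) (S K) +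
    t * sum_n (fun k => Cmod (shift_coef z n k) * t ^ k) K).
  { intro m.
    set (g := fun k => Cmod (shift_coef z m k) * t ^ k).
    set (h := fun k => Cmod (shift_coef z (S m) k) * t ^ k).
    assert (H0 : h 0%nat = Cmod z * g 0%nat).
    { unfold h, g; cbn [shift_coef pow]; rewrite Cmod_mult; ring. }
    assert (HS : forall k, h (S k) <= Cmod z * g (S k) + t * g k).
    { intro k; unfold h, g; cbn [shift_coef].
      pose proof (Cmod_triangle (z * shift_coef z m (S k)) (shift_coef z m k)) as H.
      apply (Rmult_le_compat_r (t ^ S k) _ _ (Hp _)) in H.
      rewrite Cmod_mult in H; cbn [pow] in *; lra. }
    induction K as [|K IH].
    - rewrite !Rsum_S, !Rsum_O; pose proof (HS 0%nat); lra.
    - rewrite (Rsum_S h (S K)), (Rsum_S g (S K)), (Rsum_S g K) in *.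
      pose proof (HS (S K)); lra. }
  pose proof (Cmod_ge_0 z) as Hz.
  induction n as [|n IH]; intros K.
  - induction K as [|K IH].
    + rewrite Rsum_O; simpl; rewrite Cmod_1; lra.
    + rewrite Rsum_S; change (shift_coef z 0 (S K)) with (RtoC 0).
      rewrite Cmod_0; lra.
  - destruct K as [|K].
    + rewrite Rsum_O; simpl; rewrite Cmod_mult.
      specialize (IH 0%nat); rewrite Rsum_O in IH; simpl in IH.
      assert (0 <= (Cmod z + t) ^ n) by (apply pow_le; lra).
      pose proof (Cmod_ge_0 (shift_coef z n 0)). nra.
    + eapply Rle_trans; [apply Hrec|].
      pose proof (IH (S K)); pose proof (IH K); simpl.
      rewrite Rmult_plus_distr_r.
      apply Rplus_le_compat; apply Rmult_le_compat_l; auto.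
Qed.

Lemma shift_coef_0 (z : C) (n : nat) : shift_coef z n 0 = (z ^ n)%C.
Proof. induction n as [|n IH]; [reflexivity|]; simpl; rewrite IH; reflexivity. Qed.

(** The linear coefficient is the derivative of the monomial; this is how the termwise
    differentiated series arises. *)
Lemma shift_coef_1 (z : C) (n : nat) :
  shift_coef z (S n) 1 = (INR (S n) * z ^ n)%C.
Proof.
  induction n as [|n IH].
  - simpl; ring.
  - change (shift_coef z (S (S n)) 1) with
      (z * shift_coef z (S n) 1 + shift_coef z (S n) 0)%C.
    rewrite IH, shift_coef_0, (S_INR (S n)), RtoC_plus, Cpow_S; ring.
Qed.

Lemma shift_coef_abs (z : C) (t : R) (n k : nat) : 0 <= t ->
  Cmod (shift_coef z n k) * t ^ k <= (Cmod z + t) ^ n.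
Proof.
  intro Ht; eapply Rle_trans; [|apply (shift_coef_abs_sum z t n Ht k)].
  destruct k as [|k]; [rewrite Rsum_O; lra|].
  rewrite Rsum_S.
  enough (0 <= sum_n (fun j => Cmod (shift_coef z n j) * t ^ j) k) by lra.
  induction k as [|k IH]; [rewrite Rsum_O | rewrite Rsum_S].
  - apply Rmult_le_pos; [apply Cmod_ge_0 | apply pow_le; auto].
  - apply Rplus_le_le_0_compat; auto.
    apply Rmult_le_pos; [apply Cmod_ge_0 | apply pow_le; auto].
Qed.

Lemma Rseries_incr_n (u : nat -> R) (n : nat) (l : R) :
  is_series u l -> is_series (fun k => u (S n + k)%nat) (l - sum_n u n).
Proof.
  intro H.
  apply (is_series_incr_n (V := R_NormedModule) u (S n)); [lia|].
  simpl pred.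
  match goal with |- is_series _ ?x => replace x with l; [exact H|] end.
  change (l = (l - sum_n u n) + sum_n u n); ring.
Qed.

Lemma Cseries_of_remainder (u : nat -> C) (l : C) (tau : nat -> R) :
  (forall n, Cmod (l - Csum u n) <= tau n) -> is_lim_seq tau 0 -> Cseries u l.
Proof.
  intros Hle Hlim.
  apply (filterlim_locally_ball_norm (K := C_AbsRing) (U := C_NormedModule)).
  intro eps; apply is_lim_seq_spec in Hlim.
  destruct (Hlim eps) as [N HN]; exists N; intros n Hn.
  specialize (HN n Hn); specialize (Hle n).
  change (Cmod (Csum u n - l) < eps).
  replace (Csum u n - l)%C with (- (l - Csum u n))%C by ring.
  rewrite Cmod_opp; rewrite Rminus_0_r in HN.
  pose proof (Rle_abs (tau n)); lra.
Qed.

Lemma pseries_abs_conv (a : nat -> C) (r : R) (f : C -> C) :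
  (forall z, Cmod z < r -> Cseries (fun n => (a n * z ^ n)%C) (f z)) ->
  forall s, 0 <= s < r -> ex_series (fun n => Cmod (a n) * s ^ n).
Proof.
  intros Hf s Hs.
  assert (Hr : Cmod (RtoC ((s + r) / 2)) = (s + r) / 2)
    by (rewrite Cmod_R, Rabs_pos_eq; lra).
  destruct (Cseries_terms_bounded _ _ (Hf (RtoC ((s + r) / 2)) ltac:(lra))) as [M HM].
  apply ex_series_geom_bound with M ((s + r) / 2); [lra | intro; apply Cmod_ge_0 |].
  intro n; specialize (HM n); rewrite Cmod_mult, Cmod_pow, Hr in HM; exact HM.
Qed.

(** The only interchange of sums that recentering uses: the sum over [k] is finite. *)
Lemma Cseries_finite_sum (u : nat -> nat -> C) (b w : nat -> C) (K : nat) :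
  (forall k, Cseries (fun n => u n k) (b k)) ->
  Cseries (fun n => Csum (fun k => (u n k * w k)%C) K) (Csum (fun k => (b k * w k)%C) K).
Proof.
  intro Hb.
  assert (Hw : forall k, Cseries (fun n => (u n k * w k)%C) (b k * w k)%C).
  { intro k; rewrite Cmult_comm.
    apply Cseries_ext with (fun n => (w k * u n k)%C); [intro; ring|].
    apply Cseries_scal, Hb. }
  induction K as [|K IH].
  - rewrite Csum_O.
    apply Cseries_ext with (2 := Hw 0%nat); intro; rewrite Csum_O; reflexivity.
  - rewrite Csum_S.
    apply Cseries_ext with (2 := Cseries_plus _ _ _ _ IH (Hw (S K))).
    intro; rewrite Csum_S; reflexivity.
Qed.

Lemma Csum_scal (c : C) (u : nat -> C) (n : nat) :
  Csum (fun k => (c * u k)%C) n = (c * Csum u n)%C.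
Proof.
  induction n as [|n IH]; [rewrite !Csum_O | rewrite !Csum_S, IH]; ring.
Qed.

Lemma Csum_0 (u : nat -> C) (n : nat) :
  (forall k, (k <= n)%nat -> u k = 0%C) -> Csum u n = 0%C.
Proof.
  induction n as [|n IH]; intro H.
  - rewrite Csum_O; apply H; lia.
  - rewrite Csum_S, IH, H by (auto with arith); ring.
Qed.

Lemma Csum_ext (u v : nat -> C) (n : nat) : (forall k, u k = v k) -> Csum u n = Csum v n.
Proof.
  intro H; induction n as [|n IH]; [rewrite !Csum_O | rewrite !Csum_S, IH, H]; auto.
Qed.

(** No double series is rearranged. With the new series cut at [K], the error is a series over [n]
    whose terms vanish for [n <= K] and are at most [2 * Cmod (a n) * (Cmod z + Cmod w) ^ n] beyond:
    twice the tail of a convergent series. *)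
Lemma pseries_recenter (a : nat -> C) (r : R) (f : C -> C) (z : C) :
  (forall z, Cmod z < r -> Cseries (fun n => (a n * z ^ n)%C) (f z)) ->
  Cmod z < r ->
  exists b : nat -> C,
    (forall w, Cmod w < r - Cmod z ->
       Cseries (fun n => (b n * w ^ n)%C) (f (z + w)%C)) /\
    Cseries (fun n => (INR (S n) * a (S n) * z ^ n)%C) (b 1%nat).
Proof.
  intros Hf Hz.
  pose proof (Cmod_ge_0 z) as Hz0.
  assert (Hex : forall k, exists l : C, Cseries (fun n => (a n * shift_coef z n k)%C) l).
  { intro k; set (t := (r - Cmod z) / 2).
    assert (Ht : 0 < t) by (unfold t; lra).
    assert (Htk : 0 < t ^ k) by (apply pow_lt; auto).
    apply ex_Cseries with (fun n => / t ^ k * (Cmod (a n) * (Cmod z + t) ^ n)).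
    - intro n; rewrite Cmod_mult.
      pose proof (shift_coef_abs z t n k (Rlt_le _ _ Ht)) as H.
      apply Rmult_le_compat_l with (r := Cmod (a n)) in H; [|apply Cmod_ge_0].
      apply Rmult_le_reg_r with (t ^ k); auto.
      field_simplify; lra.
    - apply (ex_series_scal_l (K := R_AbsRing) (/ t ^ k)
               (fun n => Cmod (a n) * (Cmod z + t) ^ n)).
      apply (pseries_abs_conv a r f Hf); unfold t; lra. }
  set (b := fun k => proj1_sig (constructive_indefinite_description _ (Hex k))).
  assert (Hb : forall k, Cseries (fun n => (a n * shift_coef z n k)%C) (b k)).
  { intro k; exact (proj2_sig (constructive_indefinite_description _ (Hex k))). }
  clearbody b; exists b; split.
  - intros w Hw.
    pose proof (Cmod_ge_0 w) as Hw0.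
    set (s := Cmod z + Cmod w).
    destruct (pseries_abs_conv a r f Hf s ltac:(unfold s; lra)) as [T HT].
    set (c := fun n => Cmod (a n) * s ^ n) in *.
    apply Cseries_of_remainder with (fun K => 2 * (T - sum_n c K)).
    + intro K.
      set (u := fun n => (a n * (z + w) ^ n +
                 - (1) * Csum (fun k => a n * shift_coef z n k * w ^ k) K)%C).
      assert (Hu : Cseries u (f (z + w) + - (1) * Csum (fun k => b k * w ^ k) K)%C).
      { apply Cseries_plus; [apply Hf|apply Cseries_scal].
        - eapply Rle_lt_trans; [apply Cmod_triangle|lra].
        - apply (Cseries_finite_sum (fun n k => a n * shift_coef z n k)%C b (fun k => w ^ k)%C).
          exact Hb. }
      assert (Hu' : forall n, u n = (a n * ((z + w) ^ n +
                 - (1) * Csum (fun k => shift_coef z n k * w ^ k) K))%C).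
      { intro n; unfold u.
        rewrite (Csum_ext _ (fun k => a n * (shift_coef z n k * w ^ k))%C) by (intro; ring).
        rewrite Csum_scal; ring. }
      (* For [n <= K] the expansion of [(z + w) ^ n] is complete at [K]. *)
      assert (Hu0 : Csum u K = 0%C).
      { apply Csum_0; intros n Hn; rewrite Hu', shift_coef_sum by exact Hn; ring. }
      apply (Cseries_incr_n u K) in Hu; rewrite Hu0 in Hu.
      replace (f (z + w) - Csum (fun n => b n * w ^ n) K)%C with
        (f (z + w) + - (1) * Csum (fun k => b k * w ^ k) K - 0)%C by ring.
      apply (Cseries_norm_le _ (fun n => 2 * c (S K + n)%nat) _ _ Hu).
      * apply (is_series_scal_l (K := R_AbsRing) 2 (fun n => c (S K + n)%nat)).
        apply Rseries_incr_n; exact HT.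
      * intro n; generalize (S K + n)%nat; clear n; intro n.
        rewrite Hu', Cmod_mult; unfold c.
        assert (H1 : Cmod ((z + w) ^ n) <= s ^ n).
        { rewrite Cmod_pow; apply pow_incr; split; [apply Cmod_ge_0|apply Cmod_triangle]. }
        assert (H2 : Cmod (- (1) * Csum (fun k => (shift_coef z n k * w ^ k)%C) K) <= s ^ n).
        { rewrite Cmod_mult, Cmod_m1, Rmult_1_l.
          eapply Rle_trans; [|apply (shift_coef_abs_sum z (Cmod w) n Hw0 K)].
          apply Cmod_Csum_le; intro k; rewrite Cmod_mult, Cmod_pow; lra. }
        pose proof (Cmod_triangle ((z + w) ^ n)
                      (- (1) * Csum (fun k => (shift_coef z n k * w ^ k)%C) K)) as H3.
        pose proof (Cmod_ge_0 (a n)).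
        replace (2 * (Cmod (a n) * s ^ n)) with (Cmod (a n) * (2 * s ^ n)) by ring.
        apply Rmult_le_compat_l; lra.
    + assert (Hlim : is_lim_seq (sum_n c) T) by exact HT.
      replace (Finite 0) with (Rbar_mult 2 (T - T)) by (simpl; f_equal; ring).
      apply is_lim_seq_scal_l.
      apply is_lim_seq_minus'; [apply is_lim_seq_const | exact Hlim].
  - pose proof (Cseries_incr_n _ 0 _ (Hb 1%nat)) as H.
    rewrite Csum_O in H; change (shift_coef z 0 1) with (RtoC 0) in H.
    replace (b 1%nat - a 0%nat * 0)%C with (b 1%nat) in H by ring.
    apply Cseries_ext with (2 := H); intro n.
    cbv beta; change (1 + n)%nat with (S n); rewrite shift_coef_1; ring.
Qed.

(** * Second order Taylor expansions *)

(** [K] carries no sign condition, whence [Rabs K] in the estimates that use it. *)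
Definition big_O3 (h : C -> C) : Prop :=
  exists K delta : R, 0 < delta /\
    forall w, Cmod w < delta -> Cmod (h w) <= K * Cmod w ^ 3.

Definition taylor2 (g : C -> C) (z a b c : C) : Prop :=
  big_O3 (fun w => (g (z + w) - (a + b * w + c * w * w))%C).

(** The tail from degree three on is at most [(Cmod w / (r / 2)) ^ 3] times the tail of the absolute
    series at radius [r / 2]. *)
Lemma pseries_taylor2 (b : nat -> C) (r : R) (g : C -> C) (z : C) : 0 < r ->
  (forall w, Cmod w < r -> Cseries (fun n => (b n * w ^ n)%C) (g (z + w)%C)) ->
  taylor2 g z (b 0%nat) (b 1%nat) (b 2%nat).
Proof.
  intros Hr Hg.
  destruct (pseries_abs_conv b r (fun w => g (z + w)%C) Hg (r / 2) ltac:(lra)) as [S HS].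
  apply (Rseries_incr_n _ 2) in HS.
  set (L := S - _) in HS; clearbody L.
  assert (Hr3 : 0 < (r / 2) ^ 3) by (apply pow_lt; lra).
  exists (L / (r / 2) ^ 3), (r / 2); split; [lra|].
  intros w Hw.
  assert (Hu := Hg w ltac:(lra)); apply (Cseries_incr_n _ 2) in Hu.
  rewrite !Csum_S, Csum_O in Hu.
  replace (g (z + w) - (b 0%nat + b 1%nat * w + b 2%nat * w * w))%C with
    (g (z + w) - (b 0%nat * w ^ 0 + b 1%nat * w ^ 1 + b 2%nat * w ^ 2))%C by (simpl; ring).
  replace (L / (r / 2) ^ 3 * Cmod w ^ 3) with (Cmod w ^ 3 / (r / 2) ^ 3 * L) by (field; lra).
  eapply (Cseries_norm_le _ _ _ _ Hu).
  - apply (is_series_scal_l (K := R_AbsRing) _ _ _ HS).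
  - intro n; rewrite Cmod_mult, Cmod_pow.
    match goal with |- ?x <= _ => change (x <= Cmod w ^ 3 / (r / 2) ^ 3 *
      (Cmod (b (3 + n)%nat) * (r / 2) ^ (3 + n))) end.
    rewrite !(pow_add _ 3 n).
    assert (H1 : Cmod w ^ n <= (r / 2) ^ n) by (apply pow_incr; split; [apply Cmod_ge_0|lra]).
    assert (H2 : 0 <= Cmod w ^ 3) by (apply pow_le, Cmod_ge_0).
    replace (Cmod w ^ 3 / (r / 2) ^ 3 * (Cmod (b (3 + n)%nat) * ((r / 2) ^ 3 * (r / 2) ^ n)))
      with (Cmod (b (3 + n)%nat) * (Cmod w ^ 3 * (r / 2) ^ n)) by (field; lra).
    apply Rmult_le_compat_l; [apply Cmod_ge_0|].
    apply Rmult_le_compat_l; auto.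
Qed.

Lemma taylor2_C_derive (g : C -> C) (z a b c : C) :
  taylor2 g z a b c -> C_derive g z = b.
Proof.
  intros (K & d & Hd & HK).
  assert (Hza : g z = a).
  { specialize (HK 0%C); rewrite Cmod_0 in HK; specialize (HK Hd).
    replace (g (z + 0) - (a + b * 0 + c * 0 * 0))%C with (g z - a)%C in HK
      by (rewrite Cplus_0_r; ring).
    rewrite pow_i, Rmult_0_r in HK by lia.
    assert (H : (g z - a)%C = 0%C).
    { apply Cmod_eq_0; pose proof (Cmod_ge_0 (g z - a)); lra. }
    replace (g z) with (g z - a + a)%C by ring; rewrite H; ring. }
  apply is_C_lim_unique.
  apply (filterlim_locally_ball_norm (K := C_AbsRing) (U := C_NormedModule)).
  intro eps.
  (* The difference quotient minus [b] is the remainder over [w] plus [c * w]. For [Cmod w < d] it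
     is at most [(Rabs K * d + Cmod c) * Cmod w]; the [1] makes [B] positive. *)
  set (B := Rabs K * d + Cmod c + 1).
  assert (HB : 0 < B).
  { unfold B; pose proof (Cmod_ge_0 c); pose proof (Rabs_pos K); nra. }
  assert (Hdel : 0 < Rmin d (eps / B)).
  { apply Rmin_glb_lt; [lra|]; apply Rdiv_lt_0_compat; [apply cond_pos|auto]. }
  enough (Hmain : forall y : C, Cmod (y - z) < Rmin d (eps / B) -> y <> z ->
            Cmod ((g y - g z) / (y - z) - b) < eps).
  { apply (locally_le_locally_norm (K := C_AbsRing) (V := C_NormedModule) z).
    exists (mkposreal _ Hdel); exact Hmain. }
  intros y Hy Hyz.
  set (w := (y - z)%C).
  fold w in Hy.
  assert (Hw : Cmod w < d) by (eapply Rlt_le_trans; [exact Hy|apply Rmin_l]).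
  assert (Hw2 : Cmod w < eps / B) by (eapply Rlt_le_trans; [exact Hy|apply Rmin_r]).
  assert (Hw0 : w <> 0%C).
  { intro H; apply Hyz; replace y with (w + z)%C by (unfold w; ring).
    rewrite H; ring. }
  assert (Hwp : 0 < Cmod w) by (apply Cmod_gt_0; auto).
  specialize (HK w Hw); replace (z + w)%C with y in HK by (unfold w; ring).
  fold w; rewrite Hza.
  replace ((g y - a) / w - b)%C with
    ((g y - (a + b * w + c * w * w)) / w + c * w)%C by (field; auto).
  eapply Rle_lt_trans; [apply Cmod_triangle|].
  rewrite Cmod_div, Cmod_mult by auto.
  assert (H1 : Cmod (g y - (a + b * w + c * w * w)) / Cmod w <= Rabs K * d * Cmod w).
  { apply Rle_div_l; auto.
    eapply Rle_trans; [exact HK|].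
    pose proof (Rle_abs K); pose proof (Rabs_pos K).
    assert (0 <= Cmod w * Cmod w) by nra.
    assert (K * Cmod w <= Rabs K * d) by nra.
    replace (K * Cmod w ^ 3) with (K * Cmod w * (Cmod w * Cmod w)) by ring.
    replace (Rabs K * d * Cmod w * Cmod w) with (Rabs K * d * (Cmod w * Cmod w)) by ring.
    apply Rmult_le_compat_r; auto. }
  apply Rlt_div_r in Hw2; auto.
  unfold B in Hw2; nra.
Qed.

(** Recentering at [z] turns the derivative into a coefficient, so uniform convergence of the
    differentiated series is never discussed. *)
Lemma pseries_derive (a : nat -> C) (z0 : C) (r : R) (f : C -> C) :
  (forall z, Cmod (z - z0) < r -> Cseries (fun n => (a n * (z - z0) ^ n)%C) (f z)) ->
  forall z, Cmod (z - z0) < r ->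
  Cseries (fun n => (INR (S n) * a (S n) * (z - z0) ^ n)%C) (C_derive f z).
Proof.
  intros Hf z Hz.
  destruct (pseries_recenter a r (fun u => f (z0 + u)%C) (z - z0)%C) as (b & Hb & Hb1); auto.
  { intros u Hu.
    apply (Cseries_ext (fun n => a n * (z0 + u - z0) ^ n)%C).
    - intro n; f_equal; f_equal; ring.
    - apply Hf; replace (z0 + u - z0)%C with u by ring; auto. }
  replace (C_derive f z) with (b 1%nat); [exact Hb1|symmetry].
  apply (taylor2_C_derive f z (b 0%nat) (b 1%nat) (b 2%nat)).
  apply pseries_taylor2 with (r - Cmod (z - z0)); [lra|].
  intros w Hw; replace (z + w)%C with (z0 + (z - z0 + w))%C by ring; auto.
Qed.

Lemma pseries_analytic_at (a : nat -> C) (z0 : C) (r : R) (f : C -> C) :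
  (forall z, Cmod (z - z0) < r -> Cseries (fun n => (a n * (z - z0) ^ n)%C) (f z)) ->
  forall z, Cmod (z - z0) < r -> analytic_at f z.
Proof.
  intros Hf z Hz.
  destruct (pseries_recenter a r (fun u => f (z0 + u)%C) (z - z0)%C) as (b & Hb & Hb1); auto.
  { intros u Hu.
    apply (Cseries_ext (fun n => a n * (z0 + u - z0) ^ n)%C).
    - intro n; f_equal; f_equal; ring.
    - apply Hf; replace (z0 + u - z0)%C with u by ring; auto. }
  exists b, (r - Cmod (z - z0)); split; [lra|].
  intros y Hy; apply is_pseries_Cseries.
  replace (f y) with (f (z0 + (z - z0 + (y - z))))%C by (f_equal; ring); auto.
Qed.

Lemma analytic_at_pseries (f : C -> C) (z0 : C) : analytic_at f z0 ->
  exists (a : nat -> C) (r : R), 0 < r /\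
  forall z, Cmod (z - z0) < r -> Cseries (fun n => (a n * (z - z0) ^ n)%C) (f z).
Proof.
  intros (a & r & Hr & H); exists a, r; split; auto.
  intros z Hz; apply is_pseries_Cseries; auto.
Qed.

Lemma analytic_at_derive (f : C -> C) (z : C) :
  analytic_at f z -> analytic_at (C_derive f) z.
Proof.
  intro H; destruct (analytic_at_pseries f z H) as (a & r & Hr & Ha).
  apply (pseries_analytic_at (fun n => INR (S n) * a (S n))%C z r).
  - apply pseries_derive; auto.
  - replace (z - z)%C with (RtoC 0) by ring; rewrite Cmod_0; auto.
Qed.

Lemma analytic_at_taylor2 (f : C -> C) (z : C) :
  analytic_at f z -> exists a b c, taylor2 f z a b c.
Proof.
  intro H; destruct (analytic_at_pseries f z H) as (a & r & Hr & Ha).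
  exists (a 0%nat), (a 1%nat), (a 2%nat); apply pseries_taylor2 with r; auto.
  intros w Hw.
  apply (Cseries_ext (fun n => a n * (z + w - z) ^ n)%C).
  - intro n; f_equal; f_equal; ring.
  - apply Ha; replace (z + w - z)%C with w by ring; auto.
Qed.

(** * Arithmetic of second order expansions *)

Definition locally_bounded (h : C -> C) : Prop :=
  exists M delta : R, 0 < delta /\ forall w, Cmod w < delta -> Cmod (h w) <= M.

Definition has_taylor2 (g : C -> C) (z : C) : Prop :=
  exists a b c, taylor2 g z a b c.

Lemma big_O3_ext (h k : C -> C) (delta : R) : 0 < delta ->
  (forall w, Cmod w < delta -> h w = k w) -> big_O3 h -> big_O3 k.
Proof.
  intros Hd Heq (K & d & Hd0 & HK).
  exists K, (Rmin d delta); split; [apply Rmin_glb_lt; auto|].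
  intros w Hw; rewrite <- Heq; [apply HK|]; eapply Rlt_le_trans; eauto using Rmin_l, Rmin_r.
Qed.

Lemma big_O3_plus (h k : C -> C) :
  big_O3 h -> big_O3 k -> big_O3 (fun w => h w + k w)%C.
Proof.
  intros (K & d & Hd & HK) (K' & d' & Hd' & HK').
  exists (K + K'), (Rmin d d'); split; [apply Rmin_glb_lt; auto|].
  intros w Hw.
  specialize (HK w (Rlt_le_trans _ _ _ Hw (Rmin_l _ _))).
  specialize (HK' w (Rlt_le_trans _ _ _ Hw (Rmin_r _ _))).
  pose proof (Cmod_triangle (h w) (k w)); lra.
Qed.

Lemma big_O3_mult (h k : C -> C) :
  big_O3 h -> locally_bounded k -> big_O3 (fun w => h w * k w)%C.
Proof.
  intros (K & d & Hd & HK) (M & d' & Hd' & HM).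
  exists (K * M), (Rmin d d'); split; [apply Rmin_glb_lt; auto|].
  intros w Hw.
  specialize (HK w (Rlt_le_trans _ _ _ Hw (Rmin_l _ _))).
  specialize (HM w (Rlt_le_trans _ _ _ Hw (Rmin_r _ _))).
  rewrite Cmod_mult.
  replace (K * M * Cmod w ^ 3) with (K * Cmod w ^ 3 * M) by ring.
  apply Rmult_le_compat; auto using Cmod_ge_0.
Qed.

Lemma big_O3_cube : big_O3 (fun w => w * w * w)%C.
Proof.
  exists 1, 1; split; [lra|]; intros w _; rewrite !Cmod_mult; lra.
Qed.

Lemma locally_bounded_quadratic (a b c : C) :
  locally_bounded (fun w => a + b * w + c * w * w)%C.
Proof.
  exists (Cmod a + Cmod b + Cmod c), 1; split; [lra|]; intros w Hw.
  pose proof (Cmod_ge_0 w); pose proof (Cmod_ge_0 b); pose proof (Cmod_ge_0 c).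
  pose proof (Cmod_triangle (a + b * w) (c * w * w)).
  pose proof (Cmod_triangle a (b * w)).
  rewrite !Cmod_mult in *.
  assert (Cmod b * Cmod w <= Cmod b) by nra.
  assert (Cmod c * Cmod w <= Cmod c) by nra.
  nra.
Qed.

Lemma taylor2_continuous (g : C -> C) (z a b c : C) : taylor2 g z a b c ->
  forall eta, 0 < eta ->
  exists delta, 0 < delta /\ forall w, Cmod w < delta -> Cmod (g (z + w)%C - a) < eta.
Proof.
  intros (K & d & Hd & HK) eta He.
  pose proof (Cmod_ge_0 b); pose proof (Cmod_ge_0 c); pose proof (Rabs_pos K).
  set (B := Rabs K + Cmod b + Cmod c + 1).
  assert (HB : 0 < B) by (unfold B; lra).
  exists (Rmin (Rmin d 1) (eta / B)); split.
  { repeat apply Rmin_glb_lt; try lra; apply Rdiv_lt_0_compat; auto. }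
  intros w Hw.
  assert (Hwd : Cmod w < d).
  { eapply Rlt_le_trans; [exact Hw|]; eapply Rle_trans; [apply Rmin_l|apply Rmin_l]. }
  assert (Hw1 : Cmod w < 1).
  { eapply Rlt_le_trans; [exact Hw|]; eapply Rle_trans; [apply Rmin_l|apply Rmin_r]. }
  assert (HwB : Cmod w * B < eta).
  { apply Rlt_div_r; auto; eapply Rlt_le_trans; [exact Hw|apply Rmin_r]. }
  specialize (HK w Hwd).
  replace (g (z + w) - a)%C with
    ((g (z + w) - (a + b * w + c * w * w)) + (b * w + c * w * w))%C by ring.
  pose proof (Cmod_ge_0 w).
  pose proof (Cmod_triangle (g (z + w) - (a + b * w + c * w * w))%C (b * w + c * w * w)).
  pose proof (Cmod_triangle (b * w) (c * w * w)).
  rewrite !Cmod_mult in *.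
  assert (Cmod w * Cmod w <= Cmod w) by nra.
  assert (K * Cmod w ^ 3 <= Rabs K * Cmod w).
  { apply Rle_trans with (Rabs K * Cmod w ^ 3).
    - apply Rmult_le_compat_r; [apply pow_le; auto|apply Rle_abs].
    - apply Rmult_le_compat_l; auto; simpl; nra. }
  assert (Cmod c * Cmod w * Cmod w <= Cmod c * Cmod w) by nra.
  unfold B in HwB; lra.
Qed.

Lemma taylor2_value (g : C -> C) (z a b c : C) : taylor2 g z a b c -> g z = a.
Proof.
  intro H.
  assert (H0 : Cmod (g z - a) = 0).
  { apply Rle_antisym; [|apply Cmod_ge_0].
    apply Rnot_lt_le; intro Hlt.
    destruct (taylor2_continuous _ _ _ _ _ H _ Hlt) as (d & Hd & Hc).
    specialize (Hc 0%C); rewrite Cmod_0, Cplus_0_r in Hc; specialize (Hc Hd); lra. }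
  apply Cmod_eq_0 in H0.
  replace (g z) with (g z - a + a)%C by ring; rewrite H0; ring.
Qed.

Lemma taylor2_locally_bounded (g : C -> C) (z a b c : C) : taylor2 g z a b c ->
  locally_bounded (fun w => g (z + w)%C).
Proof.
  intro H; destruct (taylor2_continuous _ _ _ _ _ H 1 Rlt_0_1) as (d & Hd & Hc).
  exists (1 + Cmod a), d; split; auto; intros w Hw; specialize (Hc w Hw).
  replace (g (z + w)%C) with (g (z + w) - a + a)%C by ring.
  eapply Rle_trans; [apply Cmod_triangle|]; lra.
Qed.

Lemma has_taylor2_ext (g h : C -> C) (z : C) (delta : R) : 0 < delta ->
  (forall w, Cmod w < delta -> g (z + w)%C = h (z + w)%C) ->
  has_taylor2 g z -> has_taylor2 h z.
Proof.
  intros Hd Heq (a & b & c & H); exists a, b, c.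
  refine (big_O3_ext _ _ delta Hd _ H); intros w Hw; cbv beta; rewrite Heq; auto.
Qed.

Lemma has_taylor2_plus (g h : C -> C) (z : C) :
  has_taylor2 g z -> has_taylor2 h z -> has_taylor2 (fun z => g z + h z)%C z.
Proof.
  intros (a & b & c & H) (a' & b' & c' & H').
  exists (a + a')%C, (b + b')%C, (c + c')%C.
  refine (big_O3_ext _ _ 1 Rlt_0_1 _ (big_O3_plus _ _ H H')).
  intros w _; ring.
Qed.

(** With [p], [q] the quadratic parts of [g], [h], the remainder is [(g - p) h + (h - q) p] plus the
    terms of degree three and four of [p q]. *)
Lemma taylor2_mult (g h : C -> C) (z a b c a' b' c' : C) :
  taylor2 g z a b c -> taylor2 h z a' b' c' ->
  taylor2 (fun z => g z * h z)%C z
    (a * a') (a * b' + b * a') (a * c' + b * b' + c * a').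
Proof.
  intros H H'.
  refine (big_O3_ext _ _ 1 Rlt_0_1 _
    (big_O3_plus _ _ (big_O3_mult _ _ H (taylor2_locally_bounded _ _ _ _ _ H'))
    (big_O3_plus _ _ (big_O3_mult _ _ H' (locally_bounded_quadratic a b c))
      (big_O3_mult _ _ big_O3_cube
        (locally_bounded_quadratic (b * c' + c * b') (c * c') 0))))).
  intros w _; ring.
Qed.

Lemma has_taylor2_mult (g h : C -> C) (z : C) :
  has_taylor2 g z -> has_taylor2 h z -> has_taylor2 (fun z => g z * h z)%C z.
Proof.
  intros (a & b & c & H) (a' & b' & c' & H').
  do 3 eexists; exact (taylor2_mult _ _ _ _ _ _ _ _ _ H H').
Qed.

Lemma has_taylor2_inv (g : C -> C) (z : C) :
  has_taylor2 g z -> g z <> 0%C -> has_taylor2 (fun z => / g z)%C z.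
Proof.
  intros (a & b & c & H) Hz.
  assert (Ha : a <> 0%C) by (rewrite <- (taylor2_value _ _ _ _ _ H); auto).
  assert (Ha0 : 0 < Cmod a / 2) by (apply Cmod_gt_0 in Ha; lra).
  destruct (taylor2_continuous _ _ _ _ _ H _ Ha0) as (d & Hd & Hc).
  assert (Hlow : forall w, Cmod w < d -> Cmod a / 2 <= Cmod (g (z + w)%C)).
  { intros w Hw; specialize (Hc w Hw).
    pose proof (Cmod_triangle (g (z + w)%C) (- (g (z + w) - a))%C) as Ht.
    replace (g (z + w) + - (g (z + w) - a))%C with a in Ht by ring.
    rewrite Cmod_opp in Ht; lra. }
  assert (Hnz : forall w, Cmod w < d -> g (z + w)%C <> 0%C).
  { intros w Hw; apply Cmod_gt_0; specialize (Hlow w Hw); lra. }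
  assert (Hinv : locally_bounded (fun w => / g (z + w))%C).
  { exists (/ (Cmod a / 2)), d; split; auto; intros w Hw.
    rewrite Cmod_inv by auto; apply Rinv_le_contravar; auto. }
  (* Solution of [(a + b w + c w^2) (q0 + q1 w + q2 w^2) = 1] modulo [w^3]. With [p], [q] these two
     factors, [1 / g - q] is [(- (g - p) q + (1 - p q)) / g], and [1 - p q] is divisible by
     [w^3]. *)
  set (q0 := (/ a)%C); set (q1 := (- b / (a * a))%C).
  set (q2 := (b * b / (a * a * a) - c / (a * a))%C).
  exists q0, q1, q2.
  refine (big_O3_ext _ _ d Hd _ (big_O3_mult _ _
    (big_O3_plus _ _ (big_O3_mult _ _ H (locally_bounded_quadratic (- q0) (- q1) (- q2)))
      (big_O3_mult _ _ big_O3_cube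
        (locally_bounded_quadratic (- (b * q2 + c * q1)) (- (c * q2)) 0))) Hinv)).
  intros w Hw; unfold q0, q1, q2; specialize (Hnz w Hw); field; auto.
Qed.

Lemma has_taylor2_id (z : C) : has_taylor2 (fun z => z) z.
Proof.
  exists z, 1%C, 0%C; exists 0, 1; split; [lra|]; intros w _.
  replace (z + w - (z + 1 * w + 0 * w * w))%C with (RtoC 0) by ring.
  rewrite Cmod_0; lra.
Qed.

Lemma has_taylor2_const (k z : C) : has_taylor2 (fun _ => k) z.
Proof.
  exists k, 0%C, 0%C; exists 0, 1; split; [lra|]; intros w _.
  replace (k - (k + 0 * w + 0 * w * w))%C with (RtoC 0) by ring.
  rewrite Cmod_0; lra.
Qed.

(** * The maximum principle *)

(** Squares [Cmod x >= Cmod y - Cmod (x - y)] when the right side is positive; otherwise the left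
    side of the claim is not positive. *)
Lemma Cmod_sqr_lower (x y : C) : Cmod y ^ 2 - 2 * Cmod y * Cmod (x - y) <= Cmod x ^ 2.
Proof.
  pose proof (Cmod_triangle x (- (x - y))) as H.
  replace (x + - (x - y))%C with y in H by ring; rewrite Cmod_opp in H.
  pose proof (Cmod_ge_0 x); pose proof (Cmod_ge_0 y); pose proof (Cmod_ge_0 (x - y)).
  destruct (Rle_dec (Cmod y) (Cmod (x - y))); nra.
Qed.

(* Averaging over the four points [z + w], [w = h, -h, ih, -ih], kills every cross term of
   [|a + b w + c w^2|^2], so the mean of [|g|^2 + eps |z|^2] exceeds its
   value at [z] by at least [eps h^2 - O(h^3)]. *)
Lemma taylor2_no_local_max (g : C -> C) (z : C) (eps delta : R) :
  has_taylor2 g z -> 0 < eps -> 0 < delta ->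
  exists w, Cmod w < delta /\
    Cmod (g z) ^ 2 + eps * Cmod z ^ 2 <
    Cmod (g (z + w)%C) ^ 2 + eps * Cmod (z + w) ^ 2.
Proof.
  intros (a & b & c & H) He Hdel.
  rewrite (taylor2_value _ _ _ _ _ H).
  destruct H as (K & d & Hd & HK).
  set (B := Cmod a + Cmod b + Cmod c).
  pose proof (Cmod_ge_0 a); pose proof (Cmod_ge_0 b); pose proof (Cmod_ge_0 c).
  pose proof (Rabs_pos K).
  assert (HB : 0 <= B) by (unfold B; lra).
  (* If the claim failed, the average would give [eps * h ^ 2 <= 2 * B * Rabs K * h ^ 3], which
     [h * Q < eps] forbids. *)
  set (Q := 2 * B * Rabs K + 1).
  assert (HQ : 0 < Q) by (unfold Q; nra).
  set (m := Rmin (Rmin d delta) (Rmin 1 (eps / Q))).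
  assert (Hm : 0 < m).
  { unfold m; repeat apply Rmin_glb_lt; try lra; apply Rdiv_lt_0_compat; auto. }
  set (h := m / 2).
  assert (Hh : 0 < h < m) by (unfold h; lra).
  assert (m <= d) by (unfold m; eapply Rle_trans; apply Rmin_l).
  assert (m <= delta) by (unfold m; eapply Rle_trans; [apply Rmin_l|apply Rmin_r]).
  assert (m <= 1) by (unfold m; eapply Rle_trans; [apply Rmin_r|apply Rmin_l]).
  assert (HmQ : m <= eps / Q) by (unfold m; eapply Rle_trans; [apply Rmin_r|apply Rmin_r]).
  assert (HhQ : h * Q < eps) by (apply Rlt_div_r; auto; lra).
  clearbody h m.
  apply NNPP; intro Hno.
  set (P := fun w => (a + b * w + c * w * w)%C).
  assert (Hw : forall w, Cmod w = h ->
    Cmod (P w) ^ 2 - 2 * B * (Rabs K * h ^ 3) + eps * Cmod (z + w) ^ 2 <=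
    Cmod a ^ 2 + eps * Cmod z ^ 2).
  { intros w Hw.
    assert (HnH : Cmod (g (z + w)%C) ^ 2 + eps * Cmod (z + w) ^ 2 <=
                  Cmod a ^ 2 + eps * Cmod z ^ 2).
    { apply Rnot_lt_le; intro Hlt; apply Hno; exists w; split; [lra|auto]. }
    specialize (HK w ltac:(lra)); fold (P w) in HK; rewrite Hw in HK.
    pose proof (Cmod_sqr_lower (g (z + w)%C) (P w)) as Hl.
    assert (HP : Cmod (P w) <= B).
    { unfold P, B.
      pose proof (Cmod_triangle (a + b * w) (c * w * w)) as T1.
      pose proof (Cmod_triangle a (b * w)) as T2.
      rewrite !Cmod_mult, Hw in T1; rewrite Cmod_mult, Hw in T2.
      assert (Cmod b * h <= Cmod b) by nra.
      assert (Cmod c * h <= Cmod c) by nra.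
      assert (Cmod c * h * h <= Cmod c * h) by nra.
      lra. }
    assert (Hh3 : 0 < h ^ 3) by (apply pow_lt; lra).
    assert (HR : Cmod (g (z + w)%C - P w) <= Rabs K * h ^ 3).
    { eapply Rle_trans; [exact HK|]; apply Rmult_le_compat_r; [lra|apply Rle_abs]. }
    pose proof (Rmult_le_compat _ _ _ _ (Cmod_ge_0 _) (Cmod_ge_0 _) HP HR).
    lra. }
  assert (E : forall w : C, Cmod w ^ 2 = h ^ 2 -> Cmod w = h).
  { intros w Hw2; apply Rsqr_inj; [apply Cmod_ge_0|lra|unfold Rsqr; lra]. }
  pose proof (Hw (h, 0) (E (h, 0) ltac:(rewrite Cmod2_alt; simpl; ring))) as H1'.
  pose proof (Hw (- h, 0) (E (- h, 0) ltac:(rewrite Cmod2_alt; simpl; ring))) as H2'.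
  pose proof (Hw (0, h) (E (0, h) ltac:(rewrite Cmod2_alt; simpl; ring))) as H3'.
  pose proof (Hw (0, - h) (E (0, - h) ltac:(rewrite Cmod2_alt; simpl; ring))) as H4'.
  assert (HsP : Cmod (P (h, 0)) ^ 2 + Cmod (P (- h, 0)) ^ 2 + Cmod (P (0, h)) ^ 2
            + Cmod (P (0, - h)) ^ 2
            = 4 * (Cmod a ^ 2 + Cmod b ^ 2 * h ^ 2 + Cmod c ^ 2 * h ^ 4)).
  { unfold P; rewrite !Cmod2_alt; destruct a, b, c; simpl; ring. }
  assert (Hsz : Cmod (z + (h, 0)) ^ 2 + Cmod (z + (- h, 0)) ^ 2 + Cmod (z + (0, h)) ^ 2
            + Cmod (z + (0, - h)) ^ 2 = 4 * (Cmod z ^ 2 + h ^ 2)).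
  { rewrite !Cmod2_alt; destruct z; simpl; ring. }
  assert (0 <= Cmod b ^ 2 * h ^ 2) by (apply Rmult_le_pos; apply pow2_ge_0).
  assert (0 <= Cmod c ^ 2 * h ^ 4).
  { apply Rmult_le_pos; [apply pow2_ge_0|apply pow_le; lra]. }
  assert (Hfin : eps * h ^ 2 <= 2 * B * (Rabs K * h ^ 3)).
  { assert (eps * (4 * (Cmod z ^ 2 + h ^ 2)) = eps * Cmod (z + (h, 0)) ^ 2 +
      eps * Cmod (z + (- h, 0)) ^ 2 + eps * Cmod (z + (0, h)) ^ 2 +
      eps * Cmod (z + (0, - h)) ^ 2) by (rewrite <- Hsz; ring).
    lra. }
  assert (Hh2 : 0 < h ^ 2) by (apply pow_lt; lra).
  replace (2 * B * (Rabs K * h ^ 3)) with (h * (2 * B * Rabs K) * h ^ 2) in Hfin by ring.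
  apply Rmult_le_reg_r in Hfin; auto.
  unfold Q in HhQ; lra.
Qed.

(** A finite cover makes local bounds global. The predicate [Q], stable under maxima, serves two
    uses: mere boundedness, and bounds strictly below a supremum. *)
Lemma disk_cover_bound (H : C -> R) (rho : R) (Q : R -> Prop) (m0 : R) :
  Q m0 -> (forall m1 m2, Q m1 -> Q m2 -> Q (Rmax m1 m2)) ->
  (forall u, Cmod u <= rho -> exists delta m, 0 < delta /\ Q m /\
     forall w, Cmod w <= rho -> Cmod (w - u) < delta -> H w <= m) ->
  exists m, Q m /\ forall w, Cmod w <= rho -> H w <= m.
Proof.
  intros Hm0 Hmax Hloc.
  assert (Hloc' : forall u, exists p : posreal * R, Q (snd p) /\
     forall w, Cmod w <= rho -> Cmod (w - u) < fst p -> H w <= snd p).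
  { intro u; destruct (Rle_dec (Cmod u) rho) as [Hu|Hu].
    - destruct (Hloc u Hu) as (d & m & Hd & Hm & Hb).
      exists (mkposreal d Hd, m); auto.
    (* The cover is taken of a square, so points outside the disk need a radius too: one that misses
       the disk. *)
    - assert (Hd : 0 < Cmod u - rho) by lra.
      exists (mkposreal _ Hd, m0); split; auto; simpl; intros w Hw Hwu.
      pose proof (Cmod_triangle w (- (w - u))) as Ht.
      replace (w + - (w - u))%C with u in Ht by ring; rewrite Cmod_opp in Ht; lra. }
  set (p := fun u => proj1_sig (constructive_indefinite_description _ (Hloc' u))).
  assert (Hp : forall u, Q (snd (p u)) /\
     forall w, Cmod w <= rho -> Cmod (w - u) < fst (p u) -> H w <= snd (p u)).
  { intro u; exact (proj2_sig (constructive_indefinite_description _ (Hloc' u))). }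
  clearbody p.
  set (pt := fun t : Compactness.Tn 2 R => (fst t, fst (snd t)) : C).
  apply NNPP; intro Hno.
  (* The radii are halved because closeness is measured per coordinate: two differences below
     [d / 2] give a modulus below [d]. *)
  apply (compactness_list 2 (- rho, (- rho, tt)) (rho, (rho, tt))
           (fun t => pos_div_2 (fst (p (pt t))))).
  intros [l Hl]; apply Hno.
  assert (Hlist : forall l : list (Compactness.Tn 2 R), exists m, Q m /\
            forall t, List.In t l -> snd (p (pt t)) <= m).
  { clear l Hl; induction l as [|t l (m & Hm & IH)].
    - exists m0; split; auto; intros t [].
    - exists (Rmax (snd (p (pt t))) m); split; [apply Hmax; [apply Hp|auto]|].
      intros s [->|Hs]; [apply Rmax_l|].
      eapply Rle_trans; [apply IH; auto|apply Rmax_r]. }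
  destruct (Hlist l) as (m & Hm & Hlm).
  exists m; split; auto; intros [x y] Hw.
  pose proof (Rmax_Cmod (x, y)) as Hxy; simpl in Hxy.
  pose proof (Rmax_l (Rabs x) (Rabs y)); pose proof (Rmax_r (Rabs x) (Rabs y)).
  destruct (Hl (x, (y, tt))) as (t & Ht & _ & Hc).
  { pose proof (proj1 (Rabs_le_between x rho) ltac:(lra)).
    pose proof (proj1 (Rabs_le_between y rho) ltac:(lra)).
    simpl; repeat split; lra. }
  eapply Rle_trans; [|apply (Hlm t Ht)].
  apply (proj2 (Hp (pt t))); auto.
  destruct t as (s & (s' & [])); destruct Hc as (Hc1 & Hc2 & _).
  unfold pt in *; simpl in *.
  set (d := pos (fst (p (s, s')))) in *.
  replace ((x, y) - (s, s'))%C with (RtoC (x - s) + Ci * RtoC (y - s'))%C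
    by (apply injective_projections; simpl; ring).
  eapply Rle_lt_trans; [apply Cmod_triangle|].
  rewrite Cmod_mult, Cmod_Ci, !Cmod_R; lra.
Qed.

(** Upper semicontinuity suffices. Were the supremum [M] not attained, each [u] would have a
    neighbourhood where [H <= (M + H u) / 2 < M], and a finite cover would push the supremum below
    [M]. *)
Lemma disk_attains_max (H : C -> R) (rho : R) : 0 <= rho ->
  (forall u eta, Cmod u <= rho -> 0 < eta -> exists delta, 0 < delta /\
     forall w, Cmod w <= rho -> Cmod (w - u) < delta -> H w < H u + eta) ->
  exists u, Cmod u <= rho /\ forall w, Cmod w <= rho -> H w <= H u.
Proof.
  intros Hrho Husc.
  assert (H0 : Cmod 0 <= rho) by (rewrite Cmod_0; auto).
  destruct (disk_cover_bound H rho (fun _ => True) 0) as (M0 & _ & HM0); auto.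
  { intros u Hu; destruct (Husc u 1 Hu Rlt_0_1) as (d & Hd & Hdw).
    exists d, (H u + 1); repeat split; auto; intros w Hw Hwu; left; auto. }
  destruct (completeness (fun x => exists w, Cmod w <= rho /\ x = H w)) as [M [HM1 HM2]].
  { exists M0; intros x (w & Hw & ->); auto. }
  { exists (H 0%C), 0%C; auto. }
  assert (HM : forall w, Cmod w <= rho -> H w <= M).
  { intros w Hw; apply HM1; exists w; auto. }
  apply NNPP; intro Hno.
  assert (Hlt : forall w, Cmod w <= rho -> H w < M).
  { intros w Hw; destruct (Rle_lt_or_eq_dec _ _ (HM w Hw)) as [|Heq]; auto.
    exfalso; apply Hno; exists w; rewrite Heq; auto. }
  destruct (disk_cover_bound H rho (fun m => m < M) (H 0%C)) as (m & Hm & Hmw).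
  - auto.
  - intros; apply Rmax_lub_lt; auto.
  - intros u Hu; specialize (Hlt u Hu).
    destruct (Husc u ((M - H u) / 2) Hu ltac:(lra)) as (d & Hd & Hdw).
    exists d, ((M + H u) / 2); repeat split; auto; [lra|].
    intros w Hw Hwu; specialize (Hdw w Hw Hwu); lra.
  - enough (M <= m) by lra.
    apply HM2; intros x (w & Hw & ->); auto.
Qed.

Lemma has_taylor2_sqr_continuous (g : C -> C) (u : C) (eps eta : R) :
  has_taylor2 g u -> 0 < eta -> exists delta, 0 < delta /\
  forall w, Cmod (w - u) < delta ->
    Cmod (g w) ^ 2 + eps * Cmod w ^ 2 < Cmod (g u) ^ 2 + eps * Cmod u ^ 2 + eta.
Proof.
  intros Hg He.
  assert (Hsq : forall k, has_taylor2 k u -> forall e, 0 < e ->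
    exists delta, 0 < delta /\ forall w, Cmod (w - u) < delta ->
      Rabs (Cmod (k w) ^ 2 - Cmod (k u) ^ 2) < e).
  { intros k (a & b & c & Hk) e Hepos.
    rewrite (taylor2_value _ _ _ _ _ Hk).
    pose proof (Cmod_ge_0 a).
    (* The difference of squares is at most [x] times a sum of moduli that is below
       [2 * Cmod a + 1]. *)
    set (x := Rmin 1 (e / (2 * Cmod a + 1))).
    assert (Hx : 0 < x).
    { apply Rmin_glb_lt; [lra|apply Rdiv_lt_0_compat; lra]. }
    assert (Hx1 : x <= 1) by apply Rmin_l.
    assert (Hx2 : x * (2 * Cmod a + 1) <= e).
    { apply Rle_div_r; [lra|apply Rmin_r]. }
    destruct (taylor2_continuous _ _ _ _ _ Hk x Hx) as (d & Hd & Hc).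
    exists d; split; auto; intros w Hw.
    specialize (Hc (w - u)%C Hw); replace (u + (w - u))%C with w in Hc by ring.
    pose proof (Cmod_triangle (k w - a) a) as T1.
    replace (k w - a + a)%C with (k w) in T1 by ring.
    pose proof (Cmod_triangle (k w) (- (k w - a))) as T2.
    replace (k w + - (k w - a))%C with a in T2 by ring; rewrite Cmod_opp in T2.
    pose proof (Cmod_ge_0 (k w)).
    replace (Cmod (k w) ^ 2 - Cmod a ^ 2) with
      ((Cmod (k w) - Cmod a) * (Cmod (k w) + Cmod a)) by ring.
    rewrite Rabs_mult, (Rabs_pos_eq (_ + _)) by lra.
    assert (Rabs (Cmod (k w) - Cmod a) < x) by (apply Rabs_lt_between; lra).
    pose proof (Rabs_pos (Cmod (k w) - Cmod a)).
    nra. }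
  destruct (Hsq g Hg (eta / 2) ltac:(lra)) as (d1 & Hd1 & H1).
  pose proof (Rabs_pos eps).
  destruct (Hsq (fun z => z) (has_taylor2_id u) (eta / 2 / (Rabs eps + 1))) as (d2 & Hd2 & H2).
  { apply Rdiv_lt_0_compat; lra. }
  exists (Rmin d1 d2); split; [apply Rmin_glb_lt; auto|]; intros w Hw.
  specialize (H1 w (Rlt_le_trans _ _ _ Hw (Rmin_l _ _))).
  specialize (H2 w (Rlt_le_trans _ _ _ Hw (Rmin_r _ _))).
  apply Rlt_div_r in H2; [|lra].
  apply Rabs_lt_between in H1.
  pose proof (Rle_abs (eps * (Cmod w ^ 2 - Cmod u ^ 2))) as Ha.
  rewrite Rabs_mult in Ha.
  pose proof (Rabs_pos (Cmod w ^ 2 - Cmod u ^ 2)).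
  nra.
Qed.

(* The maximum principle for [g] on the disks of radius [rho < 1]; the term
   [eps |z|^2] pushes the maximum to the boundary circle. *)
Lemma schwarz_order2 (g : C -> C) :
  (forall z, Cmod z < 1 -> has_taylor2 g z) ->
  (forall z, Cmod z < 1 -> Cmod z ^ 2 * Cmod (g z) <= 1) ->
  forall z, Cmod z < 1 -> Cmod (g z) <= 1.
Proof.
  intros Hg Hb z Hz.
  assert (Hrho : forall rho, 0 < rho -> Cmod z <= rho < 1 -> rho ^ 2 * Cmod (g z) <= 1).
  { intros rho Hr0 Hr.
    assert (Heps : forall eps, 0 < eps -> (rho ^ 2 * Cmod (g z)) ^ 2 <= 1 + eps).
    { intros eps He.
      destruct (disk_attains_max (fun w => Cmod (g w) ^ 2 + eps * Cmod w ^ 2) rho)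
        as (u & Hu & Hmax); [lra| |].
      { intros u eta Hu Heta.
        destruct (has_taylor2_sqr_continuous g u eps eta) as (d & Hd & Hc); auto.
        - apply Hg; lra.
        - exists d; auto. }
      pose proof (Cmod_ge_0 u); pose proof (Cmod_ge_0 z).
      destruct (Rle_lt_or_eq_dec _ _ Hu) as [Hlt|Heq].
      - exfalso.
        destruct (taylor2_no_local_max g u eps (rho - Cmod u)) as (w & Hw & Hbig);
          [apply Hg; lra | auto | lra |].
        specialize (Hmax (u + w)%C).
        pose proof (Cmod_triangle u w).
        specialize (Hmax ltac:(lra)); lra.
      (* On the circle [Cmod u = rho], so the hypothesis reads [rho ^ 2 * Cmod (g u) <= 1]; the
         perturbation costs at most [eps], which then tends to [0]. *)
      - specialize (Hmax z (proj1 Hr)); specialize (Hb u ltac:(lra)).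
        rewrite Heq in *.
        assert (Hr2 : 0 < rho ^ 2 < 1) by (simpl; nra).
        pose proof (Cmod_ge_0 (g u)).
        assert (Hs : (rho ^ 2 * Cmod (g u)) ^ 2 <= 1).
        { replace 1 with (1 ^ 2) by ring; apply pow_incr; split; [nra|auto]. }
        rewrite Rpow_mult_distr in *.
        set (r2 := rho ^ 2) in *.
        assert (0 <= Cmod z ^ 2) by apply pow2_ge_0.
        assert (Hle : Cmod (g z) ^ 2 <= Cmod (g u) ^ 2 + eps * r2) by nra.
        assert (Hr4 : 0 < r2 ^ 2 < 1) by (simpl; nra).
        apply Rmult_le_compat_l with (r := r2 ^ 2) in Hle; [|lra].
        assert (r2 ^ 2 * (eps * r2) <= eps).
        { replace (r2 ^ 2 * (eps * r2)) with (eps * (r2 ^ 2 * r2)) by ring.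
          assert (r2 ^ 2 * r2 <= 1) by nra. nra. }
        lra. }
    assert (Hsq : (rho ^ 2 * Cmod (g z)) ^ 2 <= 1).
    { apply le_epsilon; auto. }
    apply Rnot_lt_le; intro Hlt; nra. }
  apply Rnot_lt_le; intro Hlt.
  (* If [Cmod (g z) > 1] then [x < 1], and any [rho >= (1 + x) / 2] has [rho ^ 2 > x] since
     [(1 - x) ^ 2 > 0]; this contradicts [rho ^ 2 * Cmod (g z) <= 1]. *)
  set (x := / Cmod (g z)).
  assert (Hx : x * Cmod (g z) = 1) by (unfold x; field; lra).
  assert (Hx0 : 0 < x) by (apply Rinv_0_lt_compat; lra).
  assert (Hx1 : x < 1) by nra.
  pose proof (Rmax_l (Cmod z) ((1 + x) / 2)); pose proof (Rmax_r (Cmod z) ((1 + x) / 2)) as Hrx.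
  assert (Rmax (Cmod z) ((1 + x) / 2) < 1) by (apply Rmax_lub_lt; lra).
  set (rho := Rmax (Cmod z) ((1 + x) / 2)) in *.
  specialize (Hrho rho ltac:(lra) ltac:(lra)).
  assert (Hr : x < rho ^ 2).
  { apply Rlt_le_trans with (((1 + x) / 2) ^ 2).
    - assert (0 < (1 - x) ^ 2) by (apply pow_lt; lra); lra.
    - apply pow_incr; lra. }
  apply Rmult_lt_compat_r with (r := Cmod (g z)) in Hr; lra.
Qed.

(** * The upper bound *)

Lemma Cseries_at_0 (a : nat -> C) : Cseries (fun n => (a n * 0 ^ n)%C) (a 0%nat).
Proof.
  apply is_pseries_Cseries.
  exact (is_pseries_0 (K := C_AbsRing) (V := C_NormedModule) a).
Qed.

(** The value of [k] at [0] is the linear coefficient of [h], so that [k] is the sum of the shifted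
    series near [0]. *)
Lemma analytic_div_id (h : C -> C) : analytic_at h 0%C -> h 0%C = 0%C ->
  exists k : C -> C, (forall z : C, z <> 0%C -> k z = (h z / z)%C) /\ has_taylor2 k 0%C.
Proof.
  intros Hh H0; destruct (analytic_at_pseries h 0%C Hh) as (a & r & Hr & Ha).
  assert (Ha' : forall z, Cmod z < r -> Cseries (fun n => (a n * z ^ n)%C) (h z)).
  { intros z Hz; replace z with (z - 0)%C in Hz by ring.
    apply (Cseries_ext (fun n => a n * (z - 0) ^ n)%C); [|auto].
    intro n; do 2 f_equal; ring. }
  assert (Ha0 : a 0%nat = 0%C).
  { rewrite <- H0; apply (Cseries_unique _ _ _ (Cseries_at_0 a)).
    apply Ha'; rewrite Cmod_0; auto. }
  set (k := fun z : C => if excluded_middle_informative (z = 0%C) then a 1%nat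
                     else (h z / z)%C).
  assert (Hk : forall z : C, z <> 0%C -> k z = (h z / z)%C).
  { intros z Hz; unfold k; destruct (excluded_middle_informative (z = 0%C)); tauto. }
  exists k; split; auto.
  exists (a 1%nat), (a 2%nat), (a 3%nat).
  apply (pseries_taylor2 (fun n => a (S n)) r k 0%C Hr).
  intros w Hw; rewrite Cplus_0_l.
  destruct (excluded_middle_informative (w = 0%C)) as [->|Hw0].
  - replace (k 0%C) with (a 1%nat); [apply (Cseries_at_0 (fun n => a (S n)))|].
    unfold k; destruct (excluded_middle_informative (RtoC 0 = RtoC 0)); tauto.
  - rewrite Hk by auto.
    pose proof (Cseries_incr_n _ 0 _ (Ha' w Hw)) as H.
    apply (Cseries_scal (/ w)) in H.
    rewrite Csum_O, Ha0 in H.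
    replace (h w / w)%C with (/ w * (h w - 0 * w ^ 0))%C by (field; auto).
    refine (Cseries_ext _ _ _ _ H); intro n.
    change (1 + n)%nat with (S n); cbv beta; rewrite Cpow_S; field; auto.
Qed.

(** The half-plane [Re u > - c / 2] consists of the points nearer to [0] than to [- c]. *)
Lemma Cmod_le_add_real (c : R) (u : C) : 0 < c -> - c / 2 < Re u ->
  Cmod u <= Cmod (c + u).
Proof.
  intros Hc Hu.
  apply Rsqr_incr_0; try apply Cmod_ge_0.
  unfold Rsqr; pose proof (Cmod2_alt u); pose proof (Cmod2_alt (c + u)).
  destruct u as [x y]; simpl in *; nra.
Qed.

(* With [u = z f'' / f'], the function [u / (c + u)] maps the disk to itself and
   vanishes to order two at [0]; [g] is its quotient by [z ^ 2]. *)
Lemma pre_Schwarzian_bound (c : R) (f : C -> C) (z : C) :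
  0 < c -> class_F0 c f -> Cmod z < 1 ->
  (1 - Cmod z ^ 2) * Cmod (pre_Schwarzian f z) <= c.
Proof.
  intros Hc (((Han & _ & _) & Hnz & Hre) & H20) Hz.
  assert (Han1 : forall z, Cmod z < 1 -> analytic_at (C_derive f) z).
  { intros y Hy; apply analytic_at_derive, Han, Hy. }
  assert (Han2 : forall z, Cmod z < 1 -> analytic_at (C_derive2 f) z).
  { intros y Hy; apply analytic_at_derive, Han1, Hy. }
  assert (Hnz' : forall z, Cmod z < 1 -> C_derive f z <> 0%C) by exact Hnz.
  assert (H0 : Cmod 0 < 1) by (rewrite Cmod_0; lra).
  destruct (analytic_div_id (C_derive2 f) (Han2 _ H0) H20) as (k & Hk & Hk0).
  set (u := fun z => (z * C_derive2 f z / C_derive f z)%C).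
  assert (Hu : forall z, Cmod z < 1 -> - c / 2 < Re (u z)).
  { intros y Hy; specialize (Hre y Hy); fold (u y) in Hre.
    change (Re (1 + u y)) with (1 + Re (u y)) in Hre; lra. }
  assert (Hcu : forall z, Cmod z < 1 -> (c + u z)%C <> 0%C).
  { intros y Hy Heq; specialize (Hu y Hy).
    apply (f_equal Re) in Heq; change (c + Re (u y) = 0) in Heq; lra. }
  set (D := fun z => (c * C_derive f z + z * C_derive2 f z)%C).
  assert (HD : forall z, Cmod z < 1 -> D z = (C_derive f z * (c + u z))%C).
  { intros y Hy; unfold D, u; field; apply Hnz, Hy. }
  assert (HDnz : forall z, Cmod z < 1 -> D z <> 0%C).
  { intros y Hy; rewrite HD by auto; apply Cmult_neq_0; [apply Hnz|]; auto. }
  assert (Hg : Cmod (k z * / D z)%C <= 1).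
  { apply (schwarz_order2 (fun z => k z * / D z)%C); [| |exact Hz].
    - intros y Hy; apply has_taylor2_mult.
      + destruct (excluded_middle_informative (y = 0%C)) as [->|Hy0]; auto.
        (* The disk of radius [Cmod y] around [y] avoids [0], so there [k] is the plain quotient. *)
        apply (has_taylor2_ext (fun z => C_derive2 f z * / z)%C k y (Cmod y)).
        * apply Cmod_gt_0; auto.
        * intros w Hw; rewrite Hk; auto.
          intro Heq; replace w with (- y)%C in Hw by
            (rewrite <- (Cplus_0_l (- y)%C), <- Heq; ring).
          rewrite Cmod_opp in Hw; lra.
        * apply has_taylor2_mult; [apply analytic_at_taylor2; auto|].
          apply has_taylor2_inv; auto using has_taylor2_id.
      + apply has_taylor2_inv; auto.
        apply has_taylor2_plus; apply has_taylor2_mult;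
          first [apply has_taylor2_const | apply has_taylor2_id | apply analytic_at_taylor2; auto].
    - intros y Hy.
      destruct (excluded_middle_informative (y = 0%C)) as [->|Hy0].
      { rewrite Cmod_0; simpl; lra. }
      rewrite <- Cmod_pow, <- Cmod_mult.
      replace (y ^ 2 * (k y * / D y))%C with (u y / (c + u y))%C.
      + rewrite Cmod_div by auto; apply Rle_div_l.
        * apply Cmod_gt_0; auto.
        * rewrite Rmult_1_l; apply Cmod_le_add_real; auto.
      + rewrite Hk, HD by auto; specialize (Hcu y Hy).
        set (v := (c + u y)%C) in *; clearbody v; unfold u; simpl; field; auto. }
  destruct (excluded_middle_informative (z = 0%C)) as [->|Hz0].
  { unfold pre_Schwarzian; rewrite H20.
    replace (0 / C_derive f 0)%C with (RtoC 0) by (field; auto).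
    rewrite Cmod_0; lra. }
  assert (Hzp : 0 < Cmod z) by (apply Cmod_gt_0; auto).
  assert (Hle : Cmod (u z) <= Cmod z ^ 2 * Cmod (c + u z)).
  { replace (Cmod (u z)) with (Cmod z ^ 2 * (Cmod (k z * / D z) * Cmod (c + u z))).
    - assert (0 <= Cmod (c + u z)) by apply Cmod_ge_0.
      assert (0 <= Cmod z ^ 2) by apply pow2_ge_0.
      apply Rmult_le_compat_l; nra.
    - rewrite <- Cmod_pow, <- !Cmod_mult; f_equal.
      rewrite Hk, HD by auto; specialize (Hcu z Hz).
      set (v := (c + u z)%C) in *; clearbody v; unfold u; simpl; field; auto. }
  assert (HuP : Cmod (u z) = Cmod z * Cmod (pre_Schwarzian f z)).
  { rewrite <- Cmod_mult; f_equal; unfold u, pre_Schwarzian; field; auto. }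
  pose proof (Cmod_triangle c (u z)) as Ht; rewrite Cmod_R, Rabs_pos_eq in Ht by lra.
  rewrite HuP in *.
  pose proof (Cmod_ge_0 (pre_Schwarzian f z)).
  set (p := Cmod (pre_Schwarzian f z)) in *; set (x := Cmod z) in *.
  (* [Cmod (u z) = x * p]. Cancelling one [x] leaves [p <= x * (c + x * p)], that is
     [(1 - x ^ 2) * p <= c * x], and [x < 1]. *)
  assert (x * p <= x * (x * (c + x * p))) by (simpl in *; nra).
  assert (p <= x * (c + x * p)) by (apply Rmult_le_reg_l with x; auto).
  simpl; nra.
Qed.

(** * The extremal function *)

Lemma pseries_linear_growth (a : nat -> C) :
  (forall n, Cmod (a n) <= INR n + 1) ->
  exists f : C -> C, forall z, Cmod z < 1 -> Cseries (fun n => (a n * z ^ n)%C) (f z).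
Proof.
  intro Ha.
  assert (Hex : forall z, exists l : C, Cmod z < 1 -> Cseries (fun n => (a n * z ^ n)%C) l).
  { intro z; destruct (Rlt_dec (Cmod z) 1) as [Hz|]; [|exists 0%C; tauto].
    pose proof (Cmod_ge_0 z).
    set (r := (1 + Cmod z) / 2).
    assert (Hr : Cmod z < r < 1) by (unfold r; lra).
    destruct (ex_Cseries (fun n => (a n * z ^ n)%C) (fun n => (INR n + 1) * Cmod z ^ n))
      as [l Hl]; [| |exists l; auto].
    - intro n; rewrite Cmod_mult, Cmod_pow.
      apply Rmult_le_compat_r; [apply pow_le; auto|auto].
    - apply ex_series_geom_bound with (/ (1 - r)) r; [lra | intro; pose proof (pos_INR n); lra |].
      intro n.
      assert (Hx : 0 < / r - 1).
      { assert (1 < / r) by (rewrite <- Rinv_1; apply Rinv_lt_contravar; lra); lra. }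
      pose proof (poly n (/ r - 1) Hx) as Hp.
      replace (1 + (/ r - 1)) with (/ r) in Hp by ring.
      rewrite pow_inv in Hp.
      assert (Hrn : 0 < r ^ n) by (apply pow_lt; lra).
      apply Rmult_le_compat_r with (r := r ^ n) in Hp; [|lra].
      rewrite Rinv_l in Hp by lra.
      replace (/ r - 1) with ((1 - r) / r) in Hp by (field; lra).
      apply Rmult_le_reg_r with (1 - r); [lra|].
      rewrite Rinv_l by lra.
      pose proof (pos_INR n).
      assert (INR n * (1 - r) <= INR n * ((1 - r) / r)).
      { apply Rmult_le_compat_l; auto; apply Rle_div_r; [lra|nra]. }
      nra. }
  exists (fun z => proj1_sig (constructive_indefinite_description _ (Hex z))).
  intro z; exact (proj2_sig (constructive_indefinite_description _ (Hex z))).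
Qed.

(* Taylor coefficients at [0] of [(1 - z ^ 2) ^ (- c / 2)]. *)
Fixpoint binom_coef (c : R) (n : nat) : R :=
  match n with
  | O => 1
  | S O => 0
  | S (S m) => (INR m + c) / (INR m + 2) * binom_coef c m
  end.

(** Since [Rabs c <= 3], one step multiplies by at most [(n + 3) / (n + 2)], and
    [(n + 3) (n + 1) / (n + 2) <= n + 3]. Both signs of [c] are covered because the reciprocal
    series has parameter [- c]. *)
Lemma binom_coef_abs_le (c : R) (n : nat) : -3 <= c <= 3 ->
  Rabs (binom_coef c n) <= INR n + 1.
Proof.
  intro Hc.
  enough (H : Rabs (binom_coef c n) <= INR n + 1 /\
              Rabs (binom_coef c (S n)) <= INR (S n) + 1) by tauto.
  induction n as [|n [IH1 IH2]].
  - simpl; rewrite Rabs_R1, Rabs_R0; lra.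
  - split; auto.
    change (binom_coef c (S (S n))) with ((INR n + c) / (INR n + 2) * binom_coef c n).
    rewrite !S_INR; pose proof (pos_INR n).
    unfold Rdiv; rewrite !Rabs_mult, (Rabs_pos_eq (/ _)) by
      (left; apply Rinv_0_lt_compat; lra).
    assert (Rabs (INR n + c) <= INR n + 3) by (apply Rabs_le_between; lra).
    pose proof (Rabs_pos (INR n + c)); pose proof (Rabs_pos (binom_coef c n)).
    assert (Hp : Rabs (INR n + c) * Rabs (binom_coef c n) <= (INR n + 3) * (INR n + 1))
      by (apply Rmult_le_compat; auto).
    apply Rmult_le_reg_r with (INR n + 2); [lra|].
    field_simplify; [nra|lra].
Qed.

(** * The binomial series and its differential equation *)

Definition is_binom_series (c : R) (F : C -> C) : Prop :=
  forall z, Cmod z < 1 -> Cseries (fun n => (binom_coef c n * z ^ n)%C) (F z).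

Lemma disk_pseries_derive (a : nat -> C) (f : C -> C) :
  (forall z, Cmod z < 1 -> Cseries (fun n => (a n * z ^ n)%C) (f z)) ->
  forall z, Cmod z < 1 ->
  analytic_at f z /\
  Cseries (fun n => (INR (S n) * a (S n) * z ^ n)%C) (C_derive f z).
Proof.
  intros Hf z Hz.
  assert (Hf0 : forall z, Cmod (z - 0) < 1 ->
            Cseries (fun n => (a n * (z - 0) ^ n)%C) (f z)).
  { intros y Hy; replace (y - 0)%C with y in Hy by ring.
    apply (Cseries_ext (fun n => a n * y ^ n)%C); [|auto].
    intro n; do 2 f_equal; ring. }
  assert (Hz0 : Cmod (z - 0) < 1) by (replace (z - 0)%C with z by ring; auto).
  split; [exact (pseries_analytic_at a 0%C 1 f Hf0 z Hz0)|].
  refine (Cseries_ext _ _ _ _ (pseries_derive a 0%C 1 f Hf0 z Hz0)).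
  intro n; f_equal; f_equal; ring.
Qed.

Lemma binom_coef_rec (c : R) (n : nat) :
  INR (S (S n)) * binom_coef c (S (S n)) = (INR n + c) * binom_coef c n.
Proof.
  change (binom_coef c (S (S n))) with ((INR n + c) / (INR n + 2) * binom_coef c n).
  rewrite !S_INR; pose proof (pos_INR n); field; lra.
Qed.

Lemma binom_series_ode (c : R) (F : C -> C) (z : C) :
  is_binom_series c F -> Cmod z < 1 ->
  ((1 - z ^ 2) * C_derive F z = c * z * F z)%C.
Proof.
  intros HF Hz.
  destruct (disk_pseries_derive _ F HF z Hz) as [_ H1].
  pose proof (HF z Hz) as H0.
  (* Coefficient comparison from degree two on: this series is [c z (F - 1) + z^2 F'], and [HB] is
     [F'] without its first two terms, [0] and [c z]. [binom_coef_rec] equates the terms. *)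
  assert (HA : Cseries (fun n => (c * z * (binom_coef c (S n) * z ^ (S n)) +
      z * z * (INR (S n) * binom_coef c (S n) * z ^ n))%C)
      (c * z * (F z - 1) + z * z * C_derive F z)%C).
  { apply Cseries_plus; apply Cseries_scal; [|exact H1].
    pose proof (Cseries_incr_n _ 0 _ H0) as H; rewrite Csum_O in H.
    replace (F z - 1)%C with (F z - binom_coef c 0 * z ^ 0)%C by (simpl; ring).
    exact H. }
  pose proof (Cseries_incr_n _ 1 _ H1) as HB; rewrite Csum_S, Csum_O in HB.
  assert (HE : forall n, (INR (S (2 + n)) * binom_coef c (S (2 + n)) * z ^ (2 + n))%C =
      (c * z * (binom_coef c (S n) * z ^ (S n)) +
      z * z * (INR (S n) * binom_coef c (S n) * z ^ n))%C).
  { intro n; change (2 + n)%nat with (S (S n)).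
    rewrite <- RtoC_mult, binom_coef_rec, RtoC_mult, RtoC_plus, !Cpow_S; ring. }
  apply (Cseries_ext _ _ _ HE) in HB.
  apply (Cseries_unique _ _ _ HA) in HB.
  rewrite <- !RtoC_mult, binom_coef_rec in HB.
  change (binom_coef c 0) with 1 in HB; change (binom_coef c 1) with 0 in HB.
  rewrite Rmult_1_r, Rmult_0_r, Rplus_0_l in HB.
  replace ((1 - z ^ 2) * C_derive F z)%C with
    (C_derive F z - (0 * z ^ 0 + c * z ^ 1) - z * z * C_derive F z + c * z)%C
    by (simpl; ring).
  rewrite <- HB; ring.
Qed.

(* [h] is constant along every segment from [0]. *)
Lemma constant_of_zero_derivative (h : C -> C) (z : C) :
  (forall z, Cmod z < 1 -> exists a c, taylor2 h z a 0 c) ->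
  Cmod z < 1 -> h z = h 0%C.
Proof.
  intros Hh Hz.
  (* [p] stands for [Re] or [Im], which reduces the claim to real functions of [t] on [[0, 1]] with
     zero derivative. *)
  assert (Hproj : forall p : C -> R,
    (forall x y, p (x - y)%C = p x - p y) -> (forall x, Rabs (p x) <= Cmod x) ->
    p (h z) = p (h 0%C)).
  { intros p Hsub Hle.
    replace (h z) with (h (1 * z)%C) by (f_equal; ring).
    replace (h 0%C) with (h (0 * z)%C) by (f_equal; ring).
    symmetry.
    apply (eq_is_derive (fun t : R => p (h (t * z)%C)) 0 1); [|lra].
    intros t Ht; apply is_derive_Reals; intros eps Heps.
    assert (Htz : Cmod (t * z) < 1).
    { rewrite Cmod_mult, Cmod_R, Rabs_pos_eq by lra; pose proof (Cmod_ge_0 z); nra. }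
    destruct (Hh _ Htz) as (a & c & H).
    rewrite (taylor2_value _ _ _ _ _ H).
    destruct H as (K & d & Hd & HK).
    pose proof (Rabs_pos K); pose proof (Cmod_ge_0 c).
    set (B := Rabs K + Cmod c + 1).
    assert (HB : 0 < B) by (unfold B; lra).
    assert (Hdel : 0 < Rmin (Rmin d 1) (eps / B)).
    { repeat apply Rmin_glb_lt; try lra; apply Rdiv_lt_0_compat; auto. }
    exists (mkposreal _ Hdel); simpl pos; intros s Hs Hsd.
    assert (Hsd1 : Rabs s < d).
    { eapply Rlt_le_trans; [exact Hsd|]; eapply Rle_trans; [apply Rmin_l|apply Rmin_l]. }
    assert (Hs1 : Rabs s < 1).
    { eapply Rlt_le_trans; [exact Hsd|]; eapply Rle_trans; [apply Rmin_l|apply Rmin_r]. }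
    assert (HsB : Rabs s * B < eps).
    { apply Rlt_div_r; auto; eapply Rlt_le_trans; [exact Hsd|apply Rmin_r]. }
    assert (Hs0 : 0 < Rabs s) by (apply Rabs_pos_lt; auto).
    assert (Hw : Cmod (s * z) <= Rabs s).
    { rewrite Cmod_mult, Cmod_R; pose proof (Cmod_ge_0 z); nra. }
    specialize (HK (s * z)%C ltac:(lra)).
    replace (t * z + s * z)%C with ((t + s)%R * z)%C in HK by (rewrite RtoC_plus; ring).
    rewrite Rminus_0_r, <- Hsub.
    unfold Rdiv; rewrite Rabs_mult, Rabs_inv.
    apply Rlt_div_l; auto.
    eapply Rle_lt_trans; [apply Hle|].
    set (w := (s * z)%C) in *.
    replace (h ((t + s)%R * z) - a)%C with
      ((h ((t + s)%R * z) - (a + 0 * w + c * w * w)) + c * w * w)%C by ring.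
    eapply Rle_lt_trans; [apply Cmod_triangle|].
    rewrite !Cmod_mult.
    pose proof (Cmod_ge_0 w).
    assert (Cmod w * Cmod w <= Rabs s * Rabs s) by nra.
    assert (Cmod w ^ 3 <= Rabs s * Rabs s).
    { simpl; nra. }
    assert (K * Cmod w ^ 3 <= Rabs K * (Rabs s * Rabs s)).
    { apply Rle_trans with (Rabs K * Cmod w ^ 3).
      - apply Rmult_le_compat_r; [apply pow_le; auto|apply Rle_abs].
      - apply Rmult_le_compat_l; auto. }
    assert (Cmod c * Cmod w * Cmod w <= Cmod c * (Rabs s * Rabs s)).
    { rewrite Rmult_assoc; apply Rmult_le_compat_l; auto. }
    unfold B in HsB; nra. }
  apply injective_projections.
  - apply (Hproj Re); [reflexivity|apply re_le_Cmod].
  - apply (Hproj Im); [reflexivity|intro x].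
    eapply Rle_trans; [apply Rmax_r|apply Rmax_Cmod].
Qed.

Lemma analytic_taylor2_derive (f : C -> C) (z : C) : analytic_at f z ->
  exists c, taylor2 f z (f z) (C_derive f z) c.
Proof.
  intro H; destruct (analytic_at_taylor2 f z H) as (a & b & c & Ht); exists c.
  rewrite (taylor2_value _ _ _ _ _ Ht), (taylor2_C_derive _ _ _ _ _ Ht); exact Ht.
Qed.

Lemma one_minus_sqr_neq_0 (z : C) : Cmod z < 1 -> (1 - z ^ 2)%C <> 0%C.
Proof.
  intros Hz H.
  assert (Hz2 : (z ^ 2)%C = 1%C) by (replace (z ^ 2)%C with (1 - (1 - z ^ 2))%C by ring;
    rewrite H; ring).
  apply (f_equal Cmod) in Hz2; rewrite Cmod_pow, Cmod_1 in Hz2.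
  pose proof (Cmod_ge_0 z); simpl in Hz2; nra.
Qed.

Lemma binom_series_0 (c : R) (F : C -> C) : is_binom_series c F -> F 0%C = 1%C.
Proof.
  intro HF; symmetry; refine (Cseries_unique _ _ _ (Cseries_at_0 _) (HF 0%C _)).
  rewrite Cmod_0; lra.
Qed.

(* [(1 - z ^ 2) ^ (- c / 2)] and [(1 - z ^ 2) ^ (c / 2)] have product [1]. *)
Lemma binom_series_neq_0 (c : R) (F : C -> C) (z : C) : -3 <= c <= 3 ->
  is_binom_series c F -> Cmod z < 1 -> F z <> 0%C.
Proof.
  intros Hc HF Hz HFz.
  destruct (pseries_linear_growth (fun n => RtoC (binom_coef (- c) n))) as [G HG].
  { intro n; rewrite Cmod_R; apply binom_coef_abs_le; lra. }
  assert (HFG : (F z * G z)%C = (F 0%C * G 0%C)%C).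
  { apply (constant_of_zero_derivative (fun z => F z * G z)%C); auto.
    intros y Hy.
    destruct (analytic_taylor2_derive F y) as [k Hk].
    { apply (disk_pseries_derive _ F HF y Hy). }
    destruct (analytic_taylor2_derive G y) as [l Hl].
    { apply (disk_pseries_derive _ G HG y Hy). }
    pose proof (taylor2_mult _ _ _ _ _ _ _ _ _ Hk Hl) as Hm.
    replace (F y * C_derive G y + C_derive F y * G y)%C with (RtoC 0) in Hm.
    { do 2 eexists; exact Hm. }
    pose proof (one_minus_sqr_neq_0 y Hy) as Hn.
    pose proof (binom_series_ode c F y HF Hy) as EF.
    pose proof (binom_series_ode (- c) G y HG Hy) as EG.
    (* After multiplication by [1 - y ^ 2], the two equations contribute [- c y F G] and
       [c y F G]. *)
    replace (F y * C_derive G y + C_derive F y * G y)%C with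
      ((F y * ((1 - y ^ 2) * C_derive G y) + (1 - y ^ 2) * C_derive F y * G y)
        / (1 - y ^ 2))%C by (field; auto).
    rewrite EF, EG, RtoC_opp; field; auto. }
  rewrite HFz, (binom_series_0 c F HF), (binom_series_0 (- c) G HG) in HFG.
  apply (f_equal Re) in HFG; simpl in HFG; lra.
Qed.

(** The quotient [q] satisfies [q = u * (1 + q)], so it is nearer to [0] than to [- 1]. *)
Lemma Re_gt_half (u : C) : Cmod u < 1 -> (1 - u)%C <> 0%C ->
  - / 2 < Re (u / (1 - u))%C.
Proof.
  intros Hu Hn; set (q := (u / (1 - u))%C).
  assert (Hq : q = (u * (1 + q))%C) by (unfold q; field; auto).
  assert (Hq1 : (1 + q)%C = (/ (1 - u))%C) by (unfold q; field; auto).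
  assert (Hpos : 0 < Cmod (1 + q)).
  { rewrite Hq1, Cmod_inv by auto; apply Rinv_0_lt_compat, Cmod_gt_0; auto. }
  assert (Hlt : Cmod q < Cmod (1 + q)).
  { rewrite Hq at 1; rewrite Cmod_mult; nra. }
  pose proof (Cmod_ge_0 q).
  assert (Cmod q ^ 2 < Cmod (1 + q) ^ 2) by (simpl; nra).
  rewrite !Cmod2_alt in *; clearbody q; destruct q as [x y]; simpl in *; nra.
Qed.

Lemma extremal_exists (c : R) : 0 < c <= 3 ->
  exists f : C -> C, class_F0 c f /\
    forall z : C, Cmod z < 1 -> pre_Schwarzian f z = (c * z / (1 - z ^ 2))%C.
Proof.
  intro Hc.
  (* Termwise primitive of the binomial series, so that [f' = (1 - z ^ 2) ^ (- c / 2)] and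
     [f 0 = 0]. *)
  set (a := fun n => match n with O => 0 | S m => binom_coef c m / INR (S m) end).
  destruct (pseries_linear_growth (fun n => RtoC (a n))) as [f Hf].
  { intros [|n]; rewrite Cmod_R; unfold a; [rewrite Rabs_R0; simpl; lra|].
    assert (0 < INR (S n)) by apply lt_0_INR, Nat.lt_0_succ.
    unfold Rdiv; rewrite Rabs_mult, Rabs_inv, (Rabs_pos_eq (INR _)) by lra.
    apply Rle_div_l; auto.
    pose proof (binom_coef_abs_le c n ltac:(lra)).
    rewrite S_INR in *; nra. }
  assert (HF : is_binom_series c (C_derive f)).
  { intros z Hz; refine (Cseries_ext _ _ _ _ (proj2 (disk_pseries_derive _ f Hf z Hz))).
    intro n; f_equal; unfold a; rewrite <- RtoC_mult; f_equal; field.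
    apply not_0_INR; lia. }
  assert (Hode : forall z, Cmod z < 1 -> C_derive2 f z = (c * z / (1 - z ^ 2) * C_derive f z)%C).
  { intros z Hz; pose proof (one_minus_sqr_neq_0 z Hz) as Hn.
    replace (C_derive2 f z) with ((1 - z ^ 2) * C_derive2 f z / (1 - z ^ 2))%C
      by (field; auto).
    unfold C_derive2; rewrite (binom_series_ode c (C_derive f) z HF Hz); field; auto. }
  assert (Hnz : forall z, Cmod z < 1 -> C_derive f z <> 0%C).
  { intros z Hz; apply (binom_series_neq_0 c); auto; lra. }
  assert (H0 : Cmod 0 < 1) by (rewrite Cmod_0; lra).
  exists f; split.
  - split; [split; [split; [|split]|split]|].
    + intros z Hz; apply (disk_pseries_derive _ f Hf z Hz).
    + exact (Cseries_unique _ _ _ (Hf 0%C H0) (Cseries_at_0 _)).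
    + exact (binom_series_0 c _ HF).
    + exact Hnz.
    + intros z Hz; pose proof (one_minus_sqr_neq_0 z Hz) as Hn.
      assert (Hz2 : Cmod (z ^ 2) < 1).
      { rewrite Cmod_pow; pose proof (Cmod_ge_0 z); unfold unit_disk in Hz; simpl; nra. }
      pose proof (Re_gt_half (z ^ 2)%C Hz2 Hn) as Hq.
      specialize (Hnz z Hz).
      (* Here [z f'' / f' = c q] with [q = z ^ 2 / (1 - z ^ 2)], and [Re q > - 1 / 2]. *)
      replace (1 + z * C_derive2 f z / C_derive f z)%C with
        (1 + c * (z ^ 2 / (1 - z ^ 2)))%C.
      * set (q := (z ^ 2 / (1 - z ^ 2))%C) in *; clearbody q.
        destruct q as [x y]; simpl in *; nra.
      * rewrite Hode by exact Hz; field; auto.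
    + rewrite Hode by auto; unfold Cdiv; ring.
  - intros z Hz; unfold pre_Schwarzian; rewrite Hode by auto; field.
    split; [apply (one_minus_sqr_neq_0 z Hz)|auto].
Qed.

Theorem theorem2p3 (c : R) (hc : 0 < c <= 3) :
  (forall f : C -> C, class_F0 c f ->
     Rbar_le (pre_Schwarzian_norm f) (Finite c)) /\
  (exists f : C -> C, class_F0 c f /\ pre_Schwarzian_norm f = Finite c).
Proof.
  assert (Hub : forall f, class_F0 c f -> is_ub_Rbar (fun x : R => exists z : C,
    unit_disk z /\ x = (1 - Cmod z ^ 2) * Cmod (pre_Schwarzian f z)) (Finite c)).
  { intros f Hf x (z & Hz & ->); simpl; apply pre_Schwarzian_bound; auto; lra. }
  split.
  - intros f Hf; apply (Lub_Rbar_correct _); apply Hub; auto.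
  - destruct (extremal_exists c hc) as (f & Hf & HP); exists f; split; auto.
    apply is_lub_Rbar_unique; split; [apply Hub; auto|].
    intros b Hb.
    (* At a real point [r] the factor [1 - r ^ 2] cancels and leaves exactly [c * r]. *)
    assert (Hr : forall r, 0 <= r < 1 -> Rbar_le (c * r) b).
    { intros r Hr; apply Hb; exists (RtoC r).
      assert (Hrm : Cmod r = r) by (rewrite Cmod_R, Rabs_pos_eq; lra).
      split; [unfold unit_disk; lra|].
      rewrite HP, Hrm by lra.
      rewrite <- RtoC_pow, <- RtoC_minus, <- RtoC_mult, <- RtoC_div, Cmod_R
        by (simpl; nra).
      rewrite Rabs_pos_eq by (apply Rdiv_le_0_compat; simpl; nra).
      field; simpl; nra. }
    destruct b as [b| |]; simpl in *; auto; [|apply (Hr 0); lra].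
    apply Rnot_lt_le; intro Hlt.
    pose proof (Hr 0 ltac:(lra)).
    assert (0 <= (b / c + 1) / 2 < 1).
    { assert (0 <= b / c) by (apply Rdiv_le_0_compat; lra).
      assert (b / c < 1) by (apply Rlt_div_l; lra). lra. }
    (* This radius makes [c * r] the midpoint of [b] and [c], which exceeds [b]. *)
    specialize (Hr ((b / c + 1) / 2) ltac:(lra)).
    replace (c * ((b / c + 1) / 2)) with ((b + c) / 2) in Hr by (field; lra); lra.
Qed.
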